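(* Consider the class of diffusion--convection equations $u_t=(A(u)u_x)_x+B(u)u_x$ with smooth $A,B$, $A\neq0$. (i) Every equation of the class admits the local conservation law with conserved vector $$F=u,\qquad G=-A(u)u_x-\textstyle\int B,$$ where $\int B=\int B(u)\,du$ is an antiderivative. (ii) An equation of the class admits a local conservation law linearly independent of the one in (i) if and only if it is $G^{\sim}$-equivalent to one of the following; and in these cases the space of local conservation laws is as follows: (a) $B=0$, $A$ arbitrary non-constant: the space of conservation laws is spanned by the law in (i) and the law with $F=xu$, $G=\int A-xA u_x$ (here $\int A=\int A(u)du$); (b) $B=A$, $A$ arbitrary non-constant: the space is spanned by the law in (i) and the law with $F=e^xu$, $G=-e^xAu_x$; equivalently, up to $G^{\sim}$-equivalence the additional conservation law can be taken as $F=(e^x+\varepsilon)u$, $G=-(e^x+\varepsilon)Au_x-\varepsilon\int A$ with $\varepsilon\in\{0,\pm1\}$; (c) $A=1$, $B=0$ (the linear heat equation $u_t=u_{xx}$): the conservation laws are exactly those with conserved vectors $F=\alpha u$, $G=\alpha_xu-\alpha u_x$, where $\alpha(t,x)$ runs over all solutions of the backward heat equation $\alpha_t+\alpha_{xx}=0$. For all other equations of the class, every local conservation law is a constant multiple of the one in (i) (up to equivalence).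
   Context: For a system $\mathcal S$ of PDEs in two independent variables $(t,x)$ with unknown functions $z$, a local conservation law is an equation $D_tF+D_xG=0$ holding on all solutions of $\mathcal S$, where the conserved vector $(F,G)$ consists of smooth functions of $t,x$ and finitely many derivatives of $z$, and $D_t,D_x$ are total derivative operators. Two conserved vectors $(F,G)$, $(F',G')$ are equivalent if $F'=F+\hat F+D_xH$, $G'=G+\hat G-D_tH$, where $\hat F,\hat G$ vanish on the solution set of $\mathcal S$ (together with its differential consequences) and $H$ is a smooth function of $t,x$ and finitely many derivatives of $z$; a conserved vector is trivial if it is equivalent to $(0,0)$. Conservation laws are identified with equivalence classes of conserved vectors; finitely many conservation laws are linearly dependent if some nontrivial constant-coefficient linear combination of their conserved vectors is trivial. $G^{\sim}$ is the equivalence group of the class, consisting of the transformations $\tilde t=\varepsilon_4t+\varepsilon_1$, $\tilde x=\varepsilon_5x+\varepsilon_7t+\varepsilon_2$, $\tilde u=\varepsilon_6u+\varepsilon_3$, $\tilde A=\varepsilon_4^{-1}\varepsilon_5^2A$, $\tilde B=\varepsilon_4^{-1}\varepsilon_5B-\varepsilon_7$ with real constants $\varepsilon_i$, $\varepsilon_4\varepsilon_5\varepsilon_6\neq0$; two equations of the class (or two equation--conservation-law pairs) are $G^{\sim}$-equivalent if one is mapped to the other by such a transformation (conserved vectors being transformed accordingly, up to equivalence). *)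

(* Defs.v *)
From Stdlib Require Import Reals ClassicalEpsilon List.
From Coquelicot Require Import Coquelicot.
Open Scope R_scope.

(** * Jet space for one unknown u(t,x).
    A jet point assigns reals to the coordinates t, x and
    u_{ij} = d_t^i d_x^j u  (Vu 0 0 = u). *)
Inductive jvar : Type := Vt | Vx | Vu (i j : nat).

Definition jvar_eq_dec (a b : jvar) : {a = b} + {a <> b}.
Proof. decide equality; apply Nat.eq_dec. Defined.

Definition jpt := jvar -> R.
Definition dfun := jpt -> R.

Definition upd (p : jpt) (v : jvar) (s : R) : jpt :=
  fun w => if jvar_eq_dec w v then s else p w.

Definition partial (v : jvar) (f : dfun) : dfun :=
  fun p => Derive (fun s => f (upd p v s)) (p v).

Fixpoint iter_partial (vs : list jvar) (f : dfun) : dfun :=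
  match vs with nil => f | v :: vs' => partial v (iter_partial vs' f) end.

Definition depends_le (f : dfun) (N : nat) : Prop :=
  forall p q : jpt, p Vt = q Vt -> p Vx = q Vx ->
    (forall i j, (i + j <= N)%nat -> p (Vu i j) = q (Vu i j)) -> f p = f q.

Definition jcont (f : dfun) : Prop :=
  forall (p : jpt) (eps : R), 0 < eps -> exists delta, 0 < delta /\
    forall q : jpt, (forall v, Rabs (q v - p v) < delta) -> Rabs (f q - f p) < eps.

Definition jsmooth (f : dfun) : Prop :=
  (exists N, depends_le f N) /\
  (forall vs p v, ex_derive (fun s => iter_partial vs f (upd p v s)) (p v)) /\
  (forall vs, jcont (iter_partial vs f)).

(** an order bound for f (any bound gives the same total derivatives) *)
Definition dep_bound (f : dfun) : nat :=
  epsilon (inhabits 0%nat) (fun N => depends_le f N).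

Definition Dx (f : dfun) : dfun := fun p =>
  partial Vx f p +
  sum_f_R0 (fun i => sum_f_R0 (fun j => p (Vu i (S j)) * partial (Vu i j) f p)
                              (dep_bound f)) (dep_bound f).

Definition Dt (f : dfun) : dfun := fun p =>
  partial Vt f p +
  sum_f_R0 (fun i => sum_f_R0 (fun j => p (Vu (S i) j) * partial (Vu i j) f p)
                              (dep_bound f)) (dep_bound f).

Fixpoint iterD (D : dfun -> dfun) (n : nat) (f : dfun) : dfun :=
  match n with O => f | S n' => D (iterD D n' f) end.

Definition uu (p : jpt) := p (Vu 0 0).
Definition ux (p : jpt) := p (Vu 0 1).

Definition smooth1 (f : R -> R) : Prop := forall n x, ex_derive (Derive_n f n) x.

Definition in_class (A B : R -> R) : Prop :=
  smooth1 A /\ smooth1 B /\ forall u, A u <> 0.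

Definition nonconst (A : R -> R) : Prop := exists u v, A u <> A v.

Definition antideriv (I f : R -> R) : Prop := forall u, is_derive I u (f u).

Definition eqn (A B : R -> R) : dfun := fun p =>
  p (Vu 1 0) - (A (uu p) * p (Vu 0 2) + Derive A (uu p) * (ux p) ^ 2)
  - B (uu p) * ux p.

(** solution set of the equation with all its differential consequences *)
Definition sol (A B : R -> R) (p : jpt) : Prop :=
  forall i j, iterD Dt i (iterD Dx j (eqn A B)) p = 0.

Definition cvec := (dfun * dfun)%type.

Definition conserved (A B : R -> R) (cv : cvec) : Prop :=
  jsmooth (fst cv) /\ jsmooth (snd cv) /\
  forall p, sol A B p -> Dt (fst cv) p + Dx (snd cv) p = 0.

(** equivalence: F' = F + Fhat + Dx H, G' = G + Ghat - Dt H with Fhat, Ghat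
    vanishing on the solution set *)
Definition cv_equiv (A B : R -> R) (cv cv' : cvec) : Prop :=
  exists H : dfun, jsmooth H /\ forall p, sol A B p ->
    fst cv' p = fst cv p + Dx H p /\ snd cv' p = snd cv p - Dt H p.

Definition cv_zero : cvec := (fun _ => 0, fun _ => 0).
Definition cv_trivial (A B : R -> R) (cv : cvec) : Prop := cv_equiv A B cv cv_zero.

Definition cv_scale (c : R) (cv : cvec) : cvec :=
  (fun p => c * fst cv p, fun p => c * snd cv p).
Definition cv_comb2 (c1 : R) (cv1 : cvec) (c2 : R) (cv2 : cvec) : cvec :=
  (fun p => c1 * fst cv1 p + c2 * fst cv2 p, fun p => c1 * snd cv1 p + c2 * snd cv2 p).

Definition indep2 (A B : R -> R) (cv1 cv2 : cvec) : Prop :=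
  forall c1 c2, cv_trivial A B (cv_comb2 c1 cv1 c2 cv2) -> c1 = 0 /\ c2 = 0.

Definition spanned2 (A B : R -> R) (cv1 cv2 : cvec) : Prop :=
  conserved A B cv1 /\ conserved A B cv2 /\ indep2 A B cv1 cv2 /\
  forall cv, conserved A B cv -> exists c1 c2, cv_equiv A B cv (cv_comb2 c1 cv1 c2 cv2).

Definition Gequiv (A B A' B' : R -> R) : Prop :=
  (* the translations e1 (in t) and e2 (in x) do not affect A, B *)
  exists e3 e4 e5 e6 e7 : R, e4 * e5 * e6 <> 0 /\
    forall u, A' (e6 * u + e3) = e5 ^ 2 / e4 * A u /\
              B' (e6 * u + e3) = e5 / e4 * B u - e7.

Definition cv_main (A IB : R -> R) : cvec :=
  (fun p => uu p, fun p => - A (uu p) * ux p - IB (uu p)).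

Definition cv_a (A IA : R -> R) : cvec :=
  (fun p => p Vx * uu p, fun p => IA (uu p) - p Vx * A (uu p) * ux p).

Definition cv_b (A : R -> R) : cvec :=
  (fun p => exp (p Vx) * uu p, fun p => - exp (p Vx) * A (uu p) * ux p).

Definition alj (alpha : R -> R -> R) : dfun := fun p => alpha (p Vt) (p Vx).
Definition backward_heat (alpha : R -> R -> R) : Prop :=
  forall p, partial Vt (alj alpha) p + partial Vx (partial Vx (alj alpha)) p = 0.
Definition cv_c (alpha : R -> R -> R) : cvec :=
  (fun p => alj alpha p * uu p,
   fun p => partial Vx (alj alpha) p * uu p - alj alpha p * ux p).

Definition zeroF : R -> R := fun _ => 0.
Definition oneF : R -> R := fun _ => 1.

Definition exceptional (A B : R -> R) : Prop :=
  (exists A0, in_class A0 zeroF /\ nonconst A0 /\ Gequiv A B A0 zeroF) \/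
  (exists A0, in_class A0 A0 /\ nonconst A0 /\ Gequiv A B A0 A0) \/
  Gequiv A B oneF zeroF.

(* Main.v *)
(* On the solution manifold every t-derivative of u is expressed through x-derivatives, so a
   conserved vector may be taken to depend on t, x and the x-derivatives of u only, and then
   T F + D G = 0 for commuting vector fields T (evolution) and D (total x-derivative).
   If F has order n, then G has order n + 1, and applying d/du_{n+1} twice to T F + D G = 0
   leaves A d^2F/du_n^2 = 0.  Hence F = F1 u_n + F0, and for n >= 1 subtracting the total
   derivative D (int F1 du_{n-1}) lowers the order.  One ends at F = alpha(t,x) u + beta(t,x);
   beta is again a total derivative, and the terms of T F + D G = 0 linear in u give
   alpha_t + A(u) alpha_xx - B(u) alpha_x = 0 identically in t, x, u.  A nonconstant alpha
   therefore exists exactly when B is an affine function of A.  Conversely alpha u is a total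
   x-derivative only if alpha = 0, which yields all independence claims. *)
From Stdlib Require Import Reals Lra Lia List FinFun FunctionalExtensionality.
From Stdlib Require Import ClassicalEpsilon Classical.
From Coquelicot Require Import Coquelicot.
(* Imported last: Stdlib's [Rderiv.Dx] would otherwise shadow [Dx]. *)
Require Import Defs.
Open Scope R_scope.
Import ListNotations.

(** * Smooth functions on the jet space *)

(** The jet space is an infinite product and the total derivatives are defined through an order
    bound picked by [epsilon], which makes them hard to compose. They are replaced by [X c], the
    directional derivative along the vector field with components [c v]: it needs no bound, is a
    derivation, and obeys the Lie bracket formula [X_comm], from which [d/du_{k+1}, D] = d/du_k and
    [D, T] = 0 are read off. The analytic price is a chain rule for curves in the jet space and the
    smoothness of compositions and primitives. The solution set is treated as a graph: it is exactly
    the image of [Kp], and pulling back along [Kp] turns D_x, D_t into D, T. Equality modulo terms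
    vanishing on solutions thus becomes equality of functions of free coordinates. In the
    second-derivative argument the order n = 0 looks different, since A itself depends on u_0; the
    additional terms with A' occur on both sides and cancel, so one computation serves every n. *)

Lemma upd_same p v s : upd p v s v = s.
Proof. unfold upd; destruct (jvar_eq_dec v v); congruence. Qed.

Lemma upd_other p v s w : w <> v -> upd p v s w = p w.
Proof. intros n; unfold upd; destruct (jvar_eq_dec w v); congruence. Qed.

Lemma upd_upd p v s s' : upd (upd p v s) v s' = upd p v s'.
Proof.
  apply functional_extensionality; intros w; unfold upd.
  destruct (jvar_eq_dec w v); congruence.
Qed.

Lemma upd_self p v : upd p v (p v) = p.
Proof.
  apply functional_extensionality; intros w; unfold upd.
  destruct (jvar_eq_dec w v); congruence.
Qed.

Lemma upd_comm p v w a b : v <> w -> upd (upd p v a) w b = upd (upd p w b) v a.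
Proof.
  intros n; apply functional_extensionality; intros z; unfold upd.
  destruct (jvar_eq_dec z v), (jvar_eq_dec z w); congruence.
Qed.

(** [jcont] is continuity for the sup-distance uniform structure on [jvar -> R], so the library
    facts on sums, products and compositions transfer. *)
Lemma jcont_continuous f :
  jcont f <-> forall p : fct_UniformSpace jvar R_UniformSpace,
    continuous (T := fct_UniformSpace jvar R_UniformSpace) (U := R_UniformSpace) f p.
Proof.
  split.
  - intros Hf p. apply filterlim_locally; intros eps.
    destruct (Hf p eps (cond_pos eps)) as [d [Hd H]].
    exists (mkposreal d Hd); intros q Hq. apply H; intros v. apply (Hq v).
  - intros Hf p eps He.
    destruct (proj1 (filterlim_locally _ _) (Hf p) (mkposreal eps He)) as [d Hd].
    exists (d / 2); split; [apply is_pos_div_2|].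
    intros q Hq. apply (Hd q). intros v.
    apply Rlt_trans with (1 := Hq v). generalize (cond_pos d); simpl; lra.
Qed.

Lemma jcont_const c : jcont (fun _ => c).
Proof. apply jcont_continuous; intros p; apply continuous_const. Qed.

Lemma jcont_coord v : jcont (fun p => p v).
Proof. intros p eps He; exists eps; split; auto. Qed.

Lemma jcont_plus f g : jcont f -> jcont g -> jcont (fun p => f p + g p).
Proof.
  rewrite !jcont_continuous; intros Hf Hg p.
  exact (continuous_plus (V := R_NormedModule) f g p (Hf p) (Hg p)).
Qed.

Lemma jcont_mult f g : jcont f -> jcont g -> jcont (fun p => f p * g p).
Proof.
  rewrite !jcont_continuous; intros Hf Hg p.
  exact (continuous_mult (K := R_AbsRing) f g p (Hf p) (Hg p)).
Qed.

Lemma jcont_comp1 a f : (forall x, continuous a x) -> jcont f -> jcont (fun p => a (f p)).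
Proof.
  rewrite !jcont_continuous; intros Ha Hf p.
  exact (continuous_comp f a p (Hf p) (Ha _)).
Qed.

Lemma jcont_curve f (c : R -> jpt) s :
  jcont f ->
  (forall eps, 0 < eps -> exists d, 0 < d /\
     forall s', Rabs (s' - s) < d -> forall v, Rabs (c s' v - c s v) < eps) ->
  continuous (fun s => f (c s)) s.
Proof.
  intros Hf Hc. apply filterlim_locally; intros eps.
  destruct (Hf (c s) eps (cond_pos eps)) as [d [Hd H]].
  destruct (Hc d Hd) as [d' [Hd' H']].
  exists (mkposreal d' Hd'); intros s' Hs'. apply H. apply H'. exact Hs'.
Qed.

Lemma jcont_upd f p v s : jcont f -> continuous (fun s => f (upd p v s)) s.
Proof.
  intros Hf; apply (jcont_curve f (fun s => upd p v s)); auto.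
  intros eps He; exists eps; split; auto. intros s' Hs' w.
  unfold upd; destruct (jvar_eq_dec w v); auto.
  rewrite Rminus_eq_0, Rabs_R0; auto.
Qed.

Lemma jcont_upd2 f p v w a b : v <> w -> jcont f ->
  continuity_2d_pt (fun x y => f (upd (upd p v x) w y)) a b.
Proof.
  intros n Hf eps. destruct (Hf (upd (upd p v a) w b) eps (cond_pos eps)) as [d [Hd H]].
  exists (mkposreal d Hd); intros x y Hx Hy; apply H; intros z; simpl in *.
  unfold upd; destruct (jvar_eq_dec z w); auto; destruct (jvar_eq_dec z v); auto.
  rewrite Rminus_eq_0, Rabs_R0; auto.
Qed.

(** * Partial differentiability and the classes C^k *)

Definition pdiff (f : dfun) := forall v p, ex_derive (fun s => f (upd p v s)) (p v).

Lemma is_partial f p v s : pdiff f ->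
  is_derive (fun s => f (upd p v s)) s (partial v f (upd p v s)).
Proof.
  intros Hf.
  assert (H : is_derive (fun s' => f (upd (upd p v s) v s')) (upd p v s v)
                (partial v f (upd p v s))) by (apply Derive_correct, Hf).
  rewrite upd_same in H. revert H.
  apply is_derive_ext; intros s'; now rewrite upd_upd.
Qed.

Lemma partial_unique f p v l :
  is_derive (fun s => f (upd p v s)) (p v) l -> partial v f p = l.
Proof. apply is_derive_unique. Qed.

Lemma is_partial_at f p v : pdiff f ->
  is_derive (fun s => f (upd p v s)) (p v) (partial v f p).
Proof. intros H; apply Derive_correct, H. Qed.

(** The recursion peels off the first derivative taken, so closure under products and compositions
    is an induction on [k]; required for every [k], it is the smoothness part of [jsmooth]. *)
Fixpoint Cn (k : nat) (f : dfun) : Prop :=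
  jcont f /\ match k with
  | O => True
  | S k' => pdiff f /\ forall v, Cn k' (partial v f)
  end.

Lemma Cn_jcont k f : Cn k f -> jcont f.
Proof. destruct k; intros H; apply H. Qed.

Lemma Cn_pred k f : Cn (S k) f -> Cn k f.
Proof.
  revert f; induction k; intros f [H1 [H2 H3]]; simpl; [auto|].
  split; [exact H1|split; [exact H2|]]. intros v; apply IHk, H3.
Qed.

(* The iterated partials differentiate last at the head of the list, while [Cn] peels
   the first derivative, which sits at the end. *)
Lemma iter_partial_snoc vs v f :
  iter_partial (vs ++ [v]) f = iter_partial vs (partial v f).
Proof. induction vs; simpl; congruence. Qed.

Lemma Cn_all f :
  (forall k, Cn k f) <->
  (forall vs p v, ex_derive (fun s => iter_partial vs f (upd p v s)) (p v)) /\
  (forall vs, jcont (iter_partial vs f)).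
Proof.
  split.
  - intros H. assert (G : forall vs g, (forall k, Cn k g) ->
      pdiff (iter_partial vs g) /\ jcont (iter_partial vs g)).
    { induction vs as [|v vs IH] using rev_ind; intros g Hg; simpl.
      - split; [apply (Hg 1%nat)|apply (Hg O)].
      - rewrite iter_partial_snoc. apply IH; intros k; apply (Hg (S k)). }
    split; intros vs; [|now apply G]. intros p v; now apply (proj1 (G vs f H)).
  - intros H k; revert f H; induction k; intros f [H1 H2]; simpl; repeat split; auto.
    + apply (H2 nil).
    + apply (H2 nil).
    + intros v p; apply (H1 nil).
    + intros v. apply IHk; split; intros vs; rewrite <- iter_partial_snoc; auto.
Qed.

Lemma Cn_ext k f f' : (forall p, f p = f' p) -> Cn k f -> Cn k f'.
Proof. intros H; now rewrite (functional_extensionality _ _ H). Qed.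

Lemma partial_const v c : partial v (fun _ => c) = fun _ => 0.
Proof. apply functional_extensionality; intros p; exact (Derive_const c (p v)). Qed.

Lemma partial_coord v w : partial v (fun p => p w) = fun _ => if jvar_eq_dec w v then 1 else 0.
Proof.
  apply functional_extensionality; intros p; unfold partial, upd.
  destruct (jvar_eq_dec w v); [apply Derive_id|apply Derive_const].
Qed.

Lemma partial_plus v f g : pdiff f -> pdiff g ->
  partial v (fun p => f p + g p) = fun p => partial v f p + partial v g p.
Proof.
  intros Hf Hg; apply functional_extensionality; intros p.
  apply (Derive_plus (fun s => f (upd p v s)) (fun s => g (upd p v s))); auto.
Qed.

Lemma partial_mult v f g : pdiff f -> pdiff g ->
  partial v (fun p => f p * g p) = fun p => partial v f p * g p + f p * partial v g p.
Proof.
  intros Hf Hg; apply functional_extensionality; intros p.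
  unfold partial.
  rewrite (Derive_mult (fun s => f (upd p v s)) (fun s => g (upd p v s))); auto.
  now rewrite upd_self.
Qed.

Lemma partial_comp1 v a f : (forall x, ex_derive a x) -> pdiff f ->
  partial v (fun p => a (f p)) = fun p => Derive a (f p) * partial v f p.
Proof.
  intros Ha Hf; apply functional_extensionality; intros p.
  unfold partial. rewrite (Derive_comp a (fun s => f (upd p v s))); auto.
  rewrite upd_self; ring.
Qed.

Lemma pdiff_const c : pdiff (fun _ => c).
Proof. intros v p; apply ex_derive_const. Qed.

Lemma pdiff_coord w : pdiff (fun p => p w).
Proof.
  intros v p; unfold upd; destruct (jvar_eq_dec w v); [apply ex_derive_id|apply ex_derive_const].
Qed.

Lemma pdiff_plus f g : pdiff f -> pdiff g -> pdiff (fun p => f p + g p).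
Proof. intros Hf Hg v p. apply (ex_derive_plus (fun s => f (upd p v s)) (fun s => g (upd p v s))); auto. Qed.

Lemma pdiff_mult f g : pdiff f -> pdiff g -> pdiff (fun p => f p * g p).
Proof. intros Hf Hg v p. apply (ex_derive_mult (fun s => f (upd p v s)) (fun s => g (upd p v s))); auto. Qed.

Lemma pdiff_comp1 a f : (forall x, ex_derive a x) -> pdiff f -> pdiff (fun p => a (f p)).
Proof. intros Ha Hf v p. apply (ex_derive_comp a (fun s => f (upd p v s))); auto. Qed.

Lemma Cn_const k c : Cn k (fun _ => c).
Proof.
  revert c; induction k; intros c; simpl; repeat split; auto using jcont_const, pdiff_const.
  intros v; rewrite partial_const; apply IHk.
Qed.

Lemma Cn_coord k w : Cn k (fun p => p w).
Proof.
  destruct k; simpl; repeat split; auto using jcont_coord, pdiff_coord.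
  intros v; rewrite partial_coord; apply Cn_const.
Qed.

Lemma Cn_plus k f g : Cn k f -> Cn k g -> Cn k (fun p => f p + g p).
Proof.
  revert f g; induction k; intros f g [H1 H2] [H1' H2']; simpl; repeat split;
    auto using jcont_plus.
  - apply pdiff_plus; tauto.
  - intros v; rewrite partial_plus by tauto. apply IHk; [apply H2|apply H2'].
Qed.

Lemma Cn_mult k f g : Cn k f -> Cn k g -> Cn k (fun p => f p * g p).
Proof.
  revert f g; induction k; intros f g Hf Hg.
  - split; auto. apply jcont_mult; [apply Hf|apply Hg].
  (* The Leibniz rule multiplies a derivative by an undifferentiated factor, which has to be demoted
     to class [k]. *)
  - generalize (Cn_pred _ _ Hf) (Cn_pred _ _ Hg); intros Hf' Hg'.
    destruct Hf as [H1 H2], Hg as [H1' H2']; simpl; repeat split; auto using jcont_mult.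
    + apply pdiff_mult; tauto.
    + intros v; rewrite partial_mult by tauto. apply Cn_plus; apply IHk; auto; [apply H2|apply H2'].
Qed.

Lemma smooth1_ex_derive a x : smooth1 a -> ex_derive a x.
Proof. intros H; apply (H O). Qed.

Lemma smooth1_Derive a : smooth1 a -> smooth1 (Derive a).
Proof.
  intros H n x. apply ex_derive_ext with (2 := H (S n) x). intros t.
  revert t; induction n; intros t; auto. simpl. apply Derive_ext, IHn.
Qed.

Lemma smooth1_continuous a x : smooth1 a -> continuous a x.
Proof. intros H; apply (ex_derive_continuous a), smooth1_ex_derive; auto. Qed.

Lemma Cn_comp1 k a f : smooth1 a -> Cn k f -> Cn k (fun p => a (f p)).
Proof.
  revert a f; induction k; intros a f Ha Hf.
  - split; auto. apply jcont_comp1; [|apply Hf]. intros; now apply smooth1_continuous.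
  - generalize (Cn_pred _ _ Hf); intros Hf'. destruct Hf as [H1 H2]; simpl; repeat split.
    + apply jcont_comp1; auto. intros; now apply smooth1_continuous.
    + apply pdiff_comp1; [|tauto]. intros; now apply smooth1_ex_derive.
    + intros v; rewrite partial_comp1; [|intros; now apply smooth1_ex_derive|tauto].
      apply Cn_mult; [apply IHk; auto using smooth1_Derive|apply H2].
Qed.

(** An arbitrary set of coordinates lets order bounds, reduced jets, functions of (t, x) and
    functions of t alone share one set of closure lemmas. *)
Definition dep (P : jvar -> Prop) (f : dfun) :=
  forall p q : jpt, (forall v, P v -> p v = q v) -> f p = f q.

Definition box (N : nat) (v : jvar) : Prop :=
  match v with Vu i j => (i + j <= N)%nat | _ => True end.

Lemma depends_le_dep f N : depends_le f N <-> dep (box N) f.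
Proof.
  split; intros H p q Hpq.
  - apply H; intros; apply Hpq; simpl; auto.
  - intros Hx Hu; apply H; intros [| |i j]; simpl; auto.
Qed.

Lemma jsmooth_iff f : jsmooth f <-> (exists N, dep (box N) f) /\ forall k, Cn k f.
Proof.
  unfold jsmooth. rewrite Cn_all.
  assert ((exists N, depends_le f N) <-> exists N, dep (box N) f); [|tauto].
  split; intros [N H]; exists N; now apply depends_le_dep.
Qed.

Lemma dep_weak (P Q : jvar -> Prop) f : (forall v, P v -> Q v) -> dep P f -> dep Q f.
Proof. intros H Hf p q Hpq; apply Hf; auto. Qed.

Lemma dep_const P c : dep P (fun _ => c).
Proof. intros p q _; auto. Qed.

Lemma dep_coord (P : jvar -> Prop) v : P v -> dep P (fun p => p v).
Proof. intros H p q Hpq; auto. Qed.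

Lemma dep_plus P f g : dep P f -> dep P g -> dep P (fun p => f p + g p).
Proof. intros Hf Hg p q H; now rewrite (Hf p q H), (Hg p q H). Qed.

Lemma dep_minus P f g : dep P f -> dep P g -> dep P (fun p => f p - g p).
Proof. intros Hf Hg p q H; now rewrite (Hf p q H), (Hg p q H). Qed.

Lemma dep_mult P f g : dep P f -> dep P g -> dep P (fun p => f p * g p).
Proof. intros Hf Hg p q H; now rewrite (Hf p q H), (Hg p q H). Qed.

Lemma dep_comp1 P a f : dep P f -> dep P (fun p => a (f p) : R).
Proof. intros Hf p q H; now rewrite (Hf p q H). Qed.

(** Along a coordinate outside [P] the function is constant, so its partial is 0 at both points. *)
Lemma dep_partial P f v : dep P f -> dep P (partial v f).
Proof.
  intros Hf p q H; unfold partial.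
  destruct (classic (P v)) as [Pv|nPv].
  - rewrite (H v Pv). apply Derive_ext; intros s; apply Hf; intros w Pw.
    unfold upd; destruct (jvar_eq_dec w v); auto.
  - assert (E : forall p s, f (upd p v s) = f p).
    { intros; apply Hf; intros w Pw; apply upd_other; congruence. }
    rewrite (Derive_ext _ (fun _ => f p)) by (intros; apply E).
    rewrite (Derive_ext (fun s => f (upd q v s)) (fun _ => f q)) by (intros; apply E).
    now rewrite !Derive_const.
Qed.

Lemma box_mono N M v : (N <= M)%nat -> box N v -> box M v.
Proof. destruct v; simpl; lia. Qed.

Lemma jsmooth_partial f v : jsmooth f -> jsmooth (partial v f).
Proof.
  rewrite !jsmooth_iff; intros [[N H] H']; split.
  - exists N; now apply dep_partial.
  - intros k; apply (H' (S k)).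
Qed.

Lemma jsmooth_const c : jsmooth (fun _ => c).
Proof. apply jsmooth_iff; split; [exists O; apply dep_const|intros; apply Cn_const]. Qed.

Lemma jsmooth_coord v : jsmooth (fun p => p v).
Proof.
  apply jsmooth_iff; split; [|intros; apply Cn_coord].
  destruct v as [| |i j]; [exists O|exists O|exists (i + j)%nat]; apply dep_coord; simpl; auto.
Qed.

Lemma dep2 f g : (exists N, dep (box N) f) -> (exists N, dep (box N) g) ->
  exists N, dep (box N) f /\ dep (box N) g.
Proof.
  intros [N H] [M H']; exists (N + M)%nat; split.
  - apply dep_weak with (2 := H); intros v; apply box_mono; lia.
  - apply dep_weak with (2 := H'); intros v; apply box_mono; lia.
Qed.

Lemma jsmooth_plus f g : jsmooth f -> jsmooth g -> jsmooth (fun p => f p + g p).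
Proof.
  rewrite !jsmooth_iff; intros [Hf Hf'] [Hg Hg']; split.
  - destruct (dep2 f g Hf Hg) as [N [H H']]; exists N; now apply dep_plus.
  - intros k; now apply Cn_plus.
Qed.

Lemma jsmooth_mult f g : jsmooth f -> jsmooth g -> jsmooth (fun p => f p * g p).
Proof.
  rewrite !jsmooth_iff; intros [Hf Hf'] [Hg Hg']; split.
  - destruct (dep2 f g Hf Hg) as [N [H H']]; exists N; now apply dep_mult.
  - intros k; now apply Cn_mult.
Qed.

Lemma jsmooth_opp f : jsmooth f -> jsmooth (fun p => - f p).
Proof.
  intros H. assert (E : (fun p => - f p) = fun p => (-1) * f p)
    by (apply functional_extensionality; intros; ring).
  rewrite E; apply jsmooth_mult; auto using jsmooth_const.
Qed.

Lemma jsmooth_minus f g : jsmooth f -> jsmooth g -> jsmooth (fun p => f p - g p).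
Proof. intros Hf Hg; apply jsmooth_plus; auto using jsmooth_opp. Qed.

Lemma jsmooth_comp1 a f : smooth1 a -> jsmooth f -> jsmooth (fun p => a (f p)).
Proof.
  rewrite !jsmooth_iff; intros Ha [[N Hf] Hf']; split.
  - exists N; now apply dep_comp1.
  - intros k; now apply Cn_comp1.
Qed.

Lemma jsmooth_pdiff f : jsmooth f -> pdiff f.
Proof. rewrite jsmooth_iff; intros [_ H]; apply (H 1%nat). Qed.

Lemma jsmooth_jcont f : jsmooth f -> jcont f.
Proof. rewrite jsmooth_iff; intros [_ H]; apply (H O). Qed.

(** * Directional derivatives and vector fields *)

Definition lsum (l : list jvar) (h : jvar -> R) : R := fold_right (fun v a => h v + a) 0 l.

Lemma lsum_ext l h h' : (forall v, In v l -> h v = h' v) -> lsum l h = lsum l h'.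
Proof.
  induction l; intros H; simpl; auto. rewrite (H a), IHl; simpl; auto.
  intros; apply H; simpl; auto.
Qed.

Lemma lsum_plus l h h' : lsum l (fun v => h v + h' v) = lsum l h + lsum l h'.
Proof. induction l; simpl; lra. Qed.

Lemma lsum_scal l a h : lsum l (fun v => a * h v) = a * lsum l h.
Proof. induction l; simpl; [ring|rewrite IHl; ring]. Qed.

Lemma lsum_zero l : lsum l (fun _ => 0) = 0.
Proof. induction l; simpl; lra. Qed.

Lemma lsum_swap l l' (h : jvar -> jvar -> R) :
  lsum l (fun v => lsum l' (h v)) = lsum l' (fun w => lsum l (fun v => h v w)).
Proof.
  induction l; simpl; [now rewrite lsum_zero|]. rewrite IHl, <- lsum_plus; auto.
Qed.

Lemma lsum_app l l' h : lsum (l ++ l') h = lsum l h + lsum l' h.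
Proof. induction l; simpl; lra. Qed.

(** Continuity on the jet space asks for closeness uniform in infinitely many coordinates; a curve
    that moves in finitely many of them provides it by a minimum of finitely many radii. *)
Lemma curve_close (l : list jvar) (c : R -> jpt) s0 :
  (forall v, In v l -> continuous (fun s => c s v) s0) ->
  (forall v, ~ In v l -> forall s, c s v = c s0 v) ->
  forall eps, 0 < eps -> exists d, 0 < d /\
    forall s, Rabs (s - s0) < d -> forall v, Rabs (c s v - c s0 v) < eps.
Proof.
  intros Hc Hout eps He.
  assert (H : exists d, 0 < d /\ forall s, Rabs (s - s0) < d ->
            forall v, In v l -> Rabs (c s v - c s0 v) < eps).
  { clear Hout; induction l as [|v l IH].
    - exists 1; split; [lra|]. intros s _ v [].
    - destruct IH as [d [Hd H]]; [intros; apply Hc; simpl; auto|].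
      destruct (proj1 (filterlim_locally _ _) (Hc v (or_introl eq_refl)) (mkposreal eps He))
        as [d' H'].
      exists (Rmin d d'); split; [apply Rmin_glb_lt; auto; apply cond_pos|].
      intros s Hs w [<-|Hw].
      + apply (H' s). apply Rlt_le_trans with (1 := Hs), Rmin_r.
      + apply (H s); auto. apply Rlt_le_trans with (1 := Hs), Rmin_l. }
  destruct H as [d [Hd H]]; exists d; split; auto; intros s Hs v.
  destruct (classic (In v l)) as [i|n]; auto.
  rewrite (Hout v n), Rminus_eq_0, Rabs_R0; auto.
Qed.

(** The factor vanishing at [s0] compensates for [psi] being merely continuous there. It is meant
    for a [psi] coming from the mean value theorem, about whose differentiability nothing is
    known. *)
Lemma is_derive_mult_vanish (psi g : R -> R) s0 g' :
  continuous psi s0 -> is_derive g s0 g' ->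
  is_derive (fun s => psi s * (g s - g s0)) s0 (psi s0 * g').
Proof.
  intros Hpsi Hg. apply is_derive_Reals. apply is_derive_Reals in Hg.
  intros eps He.
  set (M := Rabs g' + 1). assert (HM : 0 < M) by (unfold M; generalize (Rabs_pos g'); lra).
  set (N := Rabs (psi s0) + 1). assert (HN : 0 < N) by (unfold N; generalize (Rabs_pos (psi s0)); lra).
  (* The bound 1 keeps the difference quotient of [g] within [M]; the other bound controls the error
     term with the factor [psi s0]. *)
  assert (He1 : 0 < Rmin 1 (eps / 2 / N)).
  { apply Rmin_glb_lt; [lra|]. apply Rdiv_lt_0_compat; lra. }
  destruct (Hg _ He1) as [d1 H1].
  assert (He2 : 0 < eps / 2 / M) by (apply Rdiv_lt_0_compat; lra).
  destruct (proj1 (filterlim_locally _ _) Hpsi (mkposreal _ He2)) as [d2 H2].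
  exists (mkposreal _ (Rmin_pos _ _ (cond_pos d1) (cond_pos d2))).
  intros h hn0 Hh; simpl in Hh.
  specialize (H1 h hn0 (Rlt_le_trans _ _ _ Hh (Rmin_l _ _))).
  assert (H2' : Rabs (psi (s0 + h) - psi s0) < eps / 2 / M).
  { apply (H2 (s0 + h)). change (Rabs (s0 + h - s0) < d2).
    replace (s0 + h - s0) with h by ring.
    exact (Rlt_le_trans _ _ _ Hh (Rmin_r _ _)). }
  set (q := (g (s0 + h) - g s0) / h) in *.
  assert (E : (psi (s0 + h) * (g (s0 + h) - g s0) - psi s0 * (g s0 - g s0)) / h - psi s0 * g'
     = (psi (s0 + h) - psi s0) * q + psi s0 * (q - g')) by (unfold q; field; auto).
  rewrite E. apply Rle_lt_trans with (1 := Rabs_triang _ _). rewrite !Rabs_mult.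
  assert (Hq : Rabs q <= M).
  { unfold M. replace q with (g' + (q - g')) by ring.
    apply Rle_trans with (1 := Rabs_triang _ _).
    apply Rplus_le_compat_l. left; apply Rlt_le_trans with (1 := H1), Rmin_l. }
  assert (Hq' : Rabs (q - g') < eps / 2 / N) by (apply Rlt_le_trans with (1 := H1), Rmin_r).
  apply Rlt_le_trans with (eps / 2 / M * M + N * (eps / 2 / N)); [|right; field; lra].
  apply Rplus_le_lt_compat.
  - apply Rmult_le_compat; auto using Rabs_pos. lra.
  - apply Rle_lt_trans with (Rabs (psi s0) * (eps / 2 / N)).
    + apply Rmult_le_compat_l; [apply Rabs_pos|lra].
    + apply Rmult_lt_compat_r; [apply Rdiv_lt_0_compat; lra|unfold N; lra].
Qed.

Lemma partial_MVT f p v a : Cn 1 f -> exists xi, Rabs (xi - a) <= Rabs (p v - a) /\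
  f p - f (upd p v a) = partial v f (upd p v xi) * (p v - a).
Proof.
  intros [Hf [Hd _]].
  destruct (MVT_gen (fun s => f (upd p v s)) a (p v) (fun s => partial v f (upd p v s)))
    as [xi [Hxi E]].
  - intros x _; now apply is_partial.
  - intros x _. apply continuity_pt_filterlim. now apply jcont_upd.
  - exists xi; split.
    + destruct (Rle_dec a (p v)).
      * rewrite Rmin_left, Rmax_right in Hxi by lra. rewrite !Rabs_pos_eq; lra.
      * rewrite Rmin_right, Rmax_left in Hxi by lra. rewrite !Rabs_left1; lra.
    + rewrite upd_self in E. exact E.
Qed.

(* One coordinate of the curve at a time is frozen; the increment in that coordinate is
   handled by the mean value theorem and the continuity of the partial derivative. *)
Lemma curve_list l : forall f (c : R -> jpt) s0 c',
  NoDup l -> Cn 1 f ->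
  (forall v, In v l -> is_derive (fun s => c s v) s0 (c' v)) ->
  (forall v, ~ In v l -> forall s, c s v = c s0 v) ->
  is_derive (fun s => f (c s)) s0 (lsum l (fun v => c' v * partial v f (c s0))).
Proof.
  induction l as [|v l IH]; intros f c s0 c' Hl Hf Hc Hout.
  - simpl. apply is_derive_ext with (fun _ => f (c s0)); [|apply @is_derive_const].
    intros t; f_equal; apply functional_extensionality; intros w; symmetry; apply Hout; auto.
  - inversion Hl as [|? ? Hv Hl']; subst.
    set (c1 := fun s => upd (c s) v (c s0 v)).
    assert (E1 : c1 s0 = c s0) by (unfold c1; apply upd_self).
    assert (D1 : is_derive (fun s => f (c1 s)) s0 (lsum l (fun w => c' w * partial w f (c s0)))).
    { rewrite <- E1. apply IH; auto.
      - intros w Hw. apply is_derive_ext with (fun s => c s w); [|apply Hc; simpl; auto].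
        intros s; unfold c1; rewrite upd_other; congruence.
      - intros w Hw s. rewrite E1; unfold c1, upd.
        destruct (jvar_eq_dec w v); [congruence|]. apply Hout; simpl; intuition congruence. }
    destruct (choice (fun s xi => Rabs (xi - c s0 v) <= Rabs (c s v - c s0 v) /\
      f (c s) - f (c1 s) = partial v f (upd (c s) v xi) * (c s v - c s0 v))) as [xi Hxi].
    { intros s; apply partial_MVT; auto. }
    set (psi := fun s => partial v f (upd (c s) v (xi s))).
    (* At [s0] the interval of intermediate points degenerates, so the chosen [xi] is forced there;
       nearby it is squeezed towards the same value, whence the continuity of [psi] at [s0]. *)
    assert (Exi : xi s0 = c s0 v).
    { destruct (Hxi s0) as [H _]. rewrite (Rminus_eq_0 (c s0 v)), Rabs_R0 in H.
      apply Rminus_diag_uniq. apply Rabs_eq_0. generalize (Rabs_pos (xi s0 - c s0 v)); lra. }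
    assert (Hpsi : continuous psi s0).
    { apply (jcont_curve (partial v f) (fun s => upd (c s) v (xi s))).
      - destruct Hf as [_ [_ H]]; apply (H v).
      - intros eps He. destruct (curve_close (v :: l) c s0) with (eps := eps) as [d [Hd H]]; auto.
        { intros w Hw; apply (ex_derive_continuous (fun s => c s w)); eexists; apply (Hc w Hw). }
        exists d; split; auto; intros s Hs w. unfold upd.
        destruct (jvar_eq_dec w v); [|auto].
        rewrite Exi. apply Rle_lt_trans with (1 := proj1 (Hxi s)); auto. }
    assert (D2 := is_derive_mult_vanish psi (fun s => c s v) s0 (c' v) Hpsi (Hc v (or_introl eq_refl))).
    assert (EL : lsum (v :: l) (fun w => c' w * partial w f (c s0)) =
      psi s0 * c' v + lsum l (fun w => c' w * partial w f (c s0))).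
    { unfold psi. rewrite Exi, upd_self. simpl. ring. }
    rewrite EL.
    generalize (is_derive_plus _ _ _ _ _ D2 D1).
    apply is_derive_ext; intros s. destruct (Hxi s) as [_ H].
    change (psi s * (c s v - c s0 v) + f (c1 s) = f (c s)). unfold psi. lra.
Qed.

(** A square of indices rather than the triangle i + j <= N, because it is the range of the double
    sums in [Dx] and [Dt]. *)
Definition sq (N : nat) : list jvar :=
  Vt :: Vx :: map (fun ij => Vu (fst ij) (snd ij)) (list_prod (seq 0 (S N)) (seq 0 (S N))).

Lemma NoDup_list_prod (l l' : list nat) : NoDup l -> NoDup l' -> NoDup (list_prod l l').
Proof.
  intros H H'; induction H; simpl; [constructor|].
  apply NoDup_app; auto.
  - apply Injective_map_NoDup; auto. intros a b; congruence.
  - intros [a b] H1 H2. apply in_map_iff in H1; destruct H1 as [c [E _]].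
    apply in_prod_iff in H2. injection E; intros; subst; tauto.
Qed.

Lemma sq_NoDup N : NoDup (sq N).
Proof.
  unfold sq. constructor; [|constructor].
  - intros [H|H]; [discriminate|]. apply in_map_iff in H; destruct H as [? [? _]]; discriminate.
  - intros H; apply in_map_iff in H; destruct H as [? [? _]]; discriminate.
  - apply Injective_map_NoDup.
    + intros [a b] [a' b']; simpl; congruence.
    + apply NoDup_list_prod; apply seq_NoDup.
Qed.

Lemma box_sq N v : box N v -> In v (sq N).
Proof.
  intros H; destruct v as [| |i j]; [left; auto|right; left; auto|right; right].
  apply in_map_iff; exists (i, j); split; auto. apply in_prod_iff; simpl in H.
  rewrite !in_seq; lia.
Qed.

(** The direction may have infinitely many nonzero components, and no support of [f] has to be
    named; a support is chosen only inside proofs. *)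
Definition dir (f : dfun) (p w : jpt) : R := Derive (fun s => f (fun v => p v + s * w v)) 0.

Lemma curve_lsum l f (c : R -> jpt) s0 c' :
  jsmooth f -> NoDup l -> dep (fun v => In v l) f ->
  (forall v, is_derive (fun s => c s v) s0 (c' v)) ->
  is_derive (fun s => f (c s)) s0 (lsum l (fun v => c' v * partial v f (c s0))).
Proof.
  intros Hf Hl Hd Hc.
  set (c1 := fun s v => if in_dec jvar_eq_dec v l then c s v else c s0 v).
  assert (E : c1 s0 = c s0).
  { apply functional_extensionality; intros v; unfold c1; destruct in_dec; auto. }
  rewrite <- E.
  apply is_derive_ext with (fun s => f (c1 s)).
  { intros s; apply Hd; intros v Hv; unfold c1; destruct in_dec; tauto. }
  apply (curve_list l f c1); auto.
  - apply jsmooth_iff in Hf; apply Hf.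
  - intros v Hv. apply is_derive_ext with (2 := Hc v).
    intros s; unfold c1; destruct in_dec; tauto.
  - intros v Hv s. unfold c1; destruct in_dec; tauto.
Qed.

Lemma line_derive (p w : jpt) v : is_derive (fun s => p v + s * w v) 0 (w v).
Proof. auto_derive; auto; ring. Qed.

Lemma line_0 (p w : jpt) : (fun v => p v + 0 * w v) = p.
Proof. apply functional_extensionality; intros; ring. Qed.

Lemma dir_lsum l f p w : jsmooth f -> NoDup l -> dep (fun v => In v l) f ->
  dir f p w = lsum l (fun v => w v * partial v f p).
Proof.
  intros Hf Hl Hd. apply is_derive_unique.
  generalize (curve_lsum l f (fun s v => p v + s * w v) 0 w Hf Hl Hd (line_derive p w)).
  now rewrite line_0.
Qed.

Lemma jsmooth_support f : jsmooth f -> exists l, NoDup l /\ dep (fun v => In v l) f.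
Proof.
  intros H; apply jsmooth_iff in H; destruct H as [[N H] _].
  exists (sq N); split; [apply sq_NoDup|]. apply dep_weak with (2 := H). apply box_sq.
Qed.

Lemma is_derive_curve f (c : R -> jpt) s0 c' : jsmooth f ->
  (forall v, is_derive (fun s => c s v) s0 (c' v)) ->
  is_derive (fun s => f (c s)) s0 (dir f (c s0) c').
Proof.
  intros Hf Hc. destruct (jsmooth_support f Hf) as [l [Hl Hd]].
  rewrite (dir_lsum l) by auto. apply curve_lsum; auto.
Qed.

Lemma is_derive_line f p w : jsmooth f ->
  is_derive (fun s => f (fun v => p v + s * w v)) 0 (dir f p w).
Proof.
  intros Hf. generalize (is_derive_curve f (fun s v => p v + s * w v) 0 w Hf (line_derive p w)).
  now rewrite line_0.
Qed.

Lemma dir_scal f p a w : jsmooth f -> dir f p (fun v => a * w v) = a * dir f p w.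
Proof.
  intros Hf. destruct (jsmooth_support f Hf) as [l [Hl Hd]].
  rewrite !(dir_lsum l) by auto. rewrite <- lsum_scal. apply lsum_ext; intros; ring.
Qed.

Lemma dir_ext P f p w w' : dep P f -> (forall v, P v -> w v = w' v) -> dir f p w = dir f p w'.
Proof.
  intros Hd H. apply Derive_ext; intros s. apply Hd; intros v Pv. now rewrite H.
Qed.

Definition dl (v w : jvar) : R := if jvar_eq_dec w v then 1 else 0.

Lemma partial_dir f v p : jsmooth f -> partial v f p = dir f p (dl v).
Proof.
  intros Hf. apply is_derive_unique.
  assert (E : upd p v (p v) = p) by apply upd_self.
  generalize (is_derive_curve f (fun s => upd p v s) (p v) (dl v) Hf). rewrite E. intros H; apply H.
  intros w; unfold upd, dl. destruct (jvar_eq_dec w v); [apply @is_derive_id|apply @is_derive_const].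
Qed.

(** The derivation given by the vector field with components [c v]. Total derivatives, the evolution
    field and coordinate derivatives are all instances, so their algebra is proved once. *)
Definition X (c : jvar -> dfun) (f : dfun) : dfun := fun p => dir f p (fun v => c v p).

Lemma X_lsum l c f : jsmooth f -> NoDup l -> dep (fun v => In v l) f ->
  X c f = fun p => lsum l (fun v => c v p * partial v f p).
Proof.
  intros; apply functional_extensionality; intros p; unfold X; now apply dir_lsum.
Qed.

Lemma jsmooth_lsum l (h : jvar -> dfun) :
  (forall v, jsmooth (h v)) -> jsmooth (fun p => lsum l (fun v => h v p)).
Proof.
  intros H; induction l; simpl; [apply jsmooth_const|].
  apply (jsmooth_plus (h a) (fun p => lsum l (fun v => h v p))); auto.
Qed.

Lemma jsmooth_X c f : (forall v, jsmooth (c v)) -> jsmooth f -> jsmooth (X c f).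
Proof.
  intros Hc Hf. destruct (jsmooth_support f Hf) as [l [Hl Hd]]. rewrite (X_lsum l) by auto.
  apply jsmooth_lsum; intros v. apply jsmooth_mult; auto using jsmooth_partial.
Qed.

Lemma dep_X (P Q : jvar -> Prop) c f : dep P f ->
  (forall v, P v -> Q v) -> (forall v, P v -> dep Q (c v)) -> dep Q (X c f).
Proof.
  intros Hf PQ Hc p q H. apply Derive_ext; intros s. apply Hf; intros v Pv.
  rewrite (H v), (Hc v Pv p q); auto.
Qed.

Lemma X_const c a : X c (fun _ => a) = fun _ => 0.
Proof. apply functional_extensionality; intros p. exact (Derive_const a 0). Qed.

Lemma X_coord c v : X c (fun p => p v) = c v.
Proof.
  apply functional_extensionality; intros p.
  apply is_derive_unique. apply (line_derive p (fun v => c v p)).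
Qed.

Lemma X_plus c f g : jsmooth f -> jsmooth g ->
  X c (fun p => f p + g p) = fun p => X c f p + X c g p.
Proof.
  intros Hf Hg; apply functional_extensionality; intros p. apply is_derive_unique.
  apply @is_derive_plus; now apply is_derive_line.
Qed.

Lemma X_mult c f g : jsmooth f -> jsmooth g ->
  X c (fun p => f p * g p) = fun p => X c f p * g p + f p * X c g p.
Proof.
  intros Hf Hg; apply functional_extensionality; intros p. apply is_derive_unique.
  generalize (is_derive_mult _ _ _ _ _ (is_derive_line f p (fun v => c v p) Hf)
    (is_derive_line g p (fun v => c v p) Hg) Rmult_comm).
  rewrite line_0. auto.
Qed.

Lemma X_scal c a f : jsmooth f -> X c (fun p => a * f p) = fun p => a * X c f p.
Proof.
  intros Hf; rewrite (X_mult c (fun _ => a)); auto using jsmooth_const. rewrite X_const.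
  apply functional_extensionality; intros p; ring.
Qed.

Lemma X_opp c f : jsmooth f -> X c (fun p => - f p) = fun p => - X c f p.
Proof.
  intros Hf. assert (E : (fun p => - f p) = fun p => (-1) * f p)
    by (apply functional_extensionality; intros; ring).
  rewrite E, X_scal by auto. apply functional_extensionality; intros; ring.
Qed.

Lemma X_minus c f g : jsmooth f -> jsmooth g ->
  X c (fun p => f p - g p) = fun p => X c f p - X c g p.
Proof.
  intros Hf Hg. unfold Rminus. rewrite (X_plus c f (fun p => - g p)), X_opp; auto using jsmooth_opp.
Qed.

Lemma X_comp1 c a f : smooth1 a -> jsmooth f ->
  X c (fun p => a (f p)) = fun p => Derive a (f p) * X c f p.
Proof.
  intros Ha Hf; apply functional_extensionality; intros p. apply is_derive_unique.
  assert (Da : is_derive a (f (fun v => p v + 0 * c v p)) (Derive a (f p))).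
  { rewrite (line_0 p (fun v => c v p)). apply Derive_correct. now apply smooth1_ex_derive. }
  generalize (is_derive_comp a _ _ _ _ Da (is_derive_line f p (fun v => c v p) Hf)).
  intros H. rewrite Rmult_comm. exact H.
Qed.

Lemma X_lsum_dist l c (h : jvar -> dfun) : (forall v, jsmooth (h v)) ->
  X c (fun p => lsum l (fun v => h v p)) = fun p => lsum l (fun v => X c (h v) p).
Proof.
  intros H; induction l; simpl; [apply X_const|].
  rewrite (X_plus c (h a) (fun p => lsum l (fun v => h v p))); auto using jsmooth_lsum.
  now rewrite IHl.
Qed.

Lemma partial_swap f v w p : jsmooth f -> partial v (partial w f) p = partial w (partial v f) p.
Proof.
  intros Hf. destruct (jvar_eq_dec v w) as [->|n]; auto.
  assert (n' : w <> v) by congruence.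
  set (g := fun x y => f (upd (upd p v x) w y)).
  assert (Ew : forall x y, Derive (fun z => g x z) y = partial w f (upd (upd p v x) w y)).
  { intros x y. apply is_derive_unique. apply is_partial, jsmooth_pdiff, Hf. }
  assert (Ev : forall x y, Derive (fun z => g z y) x = partial v f (upd (upd p v x) w y)).
  { intros x y. rewrite (upd_comm p v w) by auto.
    rewrite (Derive_ext _ (fun z => f (upd (upd p w y) v z)))
      by (intros; unfold g; now rewrite upd_comm).
    apply is_derive_unique. apply is_partial, jsmooth_pdiff, Hf. }
  assert (Evw : forall x y, is_derive (fun z => Derive (fun t => g z t) y) x
      (partial v (partial w f) (upd (upd p v x) w y))).
  { intros x y. rewrite (upd_comm p v w) by auto.
    apply is_derive_ext with (fun z => partial w f (upd (upd p w y) v z)).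
    - intros; rewrite Ew, upd_comm; auto.
    - apply is_partial, jsmooth_pdiff, jsmooth_partial, Hf. }
  assert (Ewv : forall x y, is_derive (fun z => Derive (fun t => g t z) x) y
      (partial w (partial v f) (upd (upd p v x) w y))).
  { intros x y.
    apply is_derive_ext with (fun z => partial v f (upd (upd p v x) w z)).
    - intros; now rewrite Ev.
    - apply is_partial, jsmooth_pdiff, jsmooth_partial, Hf. }
  assert (Ep : upd (upd p v (p v)) w (p w) = p) by (rewrite upd_self; apply upd_self).
  assert (A1 : Derive (fun z => Derive (fun t => g z t) (p w)) (p v) = partial v (partial w f) p).
  { generalize (Evw (p v) (p w)); rewrite Ep; apply is_derive_unique. }
  assert (A2 : Derive (fun z => Derive (fun t => g t z) (p v)) (p w) = partial w (partial v f) p).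
  { generalize (Ewv (p v) (p w)); rewrite Ep; apply is_derive_unique. }
  rewrite <- A1, <- A2. apply Schwarz.
  - exists (mkposreal 1 Rlt_0_1); intros x y _ _; repeat split.
    + apply ex_derive_ext with (fun z => f (upd (upd p w y) v z)).
      { intros; unfold g; now rewrite upd_comm. }
      eexists; apply is_partial, jsmooth_pdiff, Hf.
    + eexists; apply (is_partial f (upd p v x) w), jsmooth_pdiff, Hf.
    + eexists; apply Evw.
    + eexists; apply Ewv.
  - apply continuity_2d_pt_ext with (fun x y => partial v (partial w f) (upd (upd p v x) w y)).
    { intros x y; symmetry; apply is_derive_unique, Evw. }
    apply jcont_upd2; auto. apply jsmooth_jcont; auto using jsmooth_partial.
  - apply continuity_2d_pt_ext with (fun x y => partial w (partial v f) (upd (upd p v x) w y)).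
    { intros x y; symmetry; apply is_derive_unique, Ewv. }
    apply jcont_upd2; auto. apply jsmooth_jcont; auto using jsmooth_partial.
Qed.

(** The second-order terms of the two compositions agree by the symmetry of mixed partials; what
    remains is the Lie bracket of the two fields. *)
Lemma X_comm c d f p : jsmooth f -> (forall v, jsmooth (c v)) -> (forall v, jsmooth (d v)) ->
  X c (X d f) p = X d (X c f) p + dir f p (fun v => X c (d v) p - X d (c v) p).
Proof.
  intros Hf Hc Hd. destruct (jsmooth_support f Hf) as [l [Hl Hdep]].
  assert (E : forall c d, (forall v, jsmooth (c v)) -> (forall v, jsmooth (d v)) ->
    X c (X d f) p = lsum l (fun v => X c (d v) p * partial v f p) +
      lsum l (fun v => lsum l (fun w => c w p * d v p * partial w (partial v f) p))).
  { clear c d Hc Hd; intros c d Hc Hd. rewrite (X_lsum l d f) by auto.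
    rewrite (X_lsum_dist l c (fun v p => d v p * partial v f p))
      by (intros; apply jsmooth_mult; auto using jsmooth_partial).
    rewrite <- lsum_plus. apply lsum_ext; intros v _.
    rewrite (X_mult c (d v) (partial v f)) by auto using jsmooth_partial. f_equal.
    rewrite (X_lsum l c (partial v f)) by auto using jsmooth_partial, dep_partial.
    rewrite <- lsum_scal. apply lsum_ext; intros; ring. }
  rewrite (E c d), (E d c) by auto. rewrite (dir_lsum l) by auto.
  rewrite (lsum_swap l l (fun v w => d w p * c v p * partial w (partial v f) p)).
  assert (E2 : lsum l (fun w => lsum l (fun v => d w p * c v p * partial w (partial v f) p)) =
     lsum l (fun v => lsum l (fun w => c w p * d v p * partial w (partial v f) p))).
  { apply lsum_ext; intros v _; apply lsum_ext; intros w _.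
    rewrite (partial_swap f v w) by auto. ring. }
  rewrite E2.
  rewrite (lsum_ext l (fun v => (X c (d v) p - X d (c v) p) * partial v f p)
     (fun v => X c (d v) p * partial v f p + (-1) * (X d (c v) p * partial v f p)))
    by (intros; ring).
  rewrite lsum_plus, lsum_scal. ring.
Qed.

Lemma Cn_lsum k l (h : jvar -> dfun) :
  (forall v, Cn k (h v)) -> Cn k (fun p => lsum l (fun v => h v p)).
Proof.
  intros H; induction l; simpl; [apply Cn_const|].
  apply (Cn_plus k (h a) (fun p => lsum l (fun v => h v p))); auto.
Qed.

(** * Composition with a smooth map of the jet space *)

Section Composition.
Variable g : jvar -> dfun.
Hypothesis Hg : forall v, jsmooth (g v).
Let pull (f : dfun) : dfun := fun p => f (fun v => g v p).

Lemma is_derive_pull f (c : R -> jpt) s0 c' : jsmooth f ->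
  (forall v, is_derive (fun s => c s v) s0 (c' v)) ->
  is_derive (fun s => pull f (c s)) s0 (dir f (fun v => g v (c s0)) (fun v => dir (g v) (c s0) c')).
Proof.
  intros Hf Hc. apply (is_derive_curve f (fun s v => g v (c s))); auto.
  intros v; now apply is_derive_curve.
Qed.

Lemma X_pull c f p : jsmooth f ->
  X c (pull f) p = dir f (fun v => g v p) (fun v => X c (g v) p).
Proof.
  intros Hf. apply is_derive_unique.
  generalize (is_derive_pull f (fun s v => p v + s * c v p) 0 (fun v => c v p) Hf
    (line_derive p (fun v => c v p))).
  now rewrite (line_0 p (fun v => c v p)).
Qed.

Lemma is_derive_partial_pull f v p : jsmooth f ->
  is_derive (fun s => pull f (upd p v s)) (p v)
    (dir f (fun w => g w p) (fun w => partial v (g w) p)).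
Proof.
  intros Hf.
  generalize (is_derive_curve f (fun s w => g w (upd p v s)) (p v) (fun w => partial v (g w) p) Hf).
  rewrite upd_self. intros H; apply H. intros w. apply is_partial_at, jsmooth_pdiff, Hg.
Qed.

(** By the chain rule a partial of the composite is a finite sum of products
    [partial v (g w) * pull (partial w f)], to which the induction hypothesis on the class
    applies. *)
Lemma jsmooth_pull f : jsmooth f -> jsmooth (pull f).
Proof.
  intros Hf. apply jsmooth_iff; split.
  - destruct (jsmooth_support f Hf) as [l [_ Hd]].
    assert (H : exists N, forall v, In v l -> dep (box N) (g v)).
    { clear Hd; induction l as [|v l [N IH]]; [exists O; intros v []|].
      destruct (proj1 (proj1 (jsmooth_iff _) (Hg v))) as [M HM].
      exists (N + M)%nat; intros w [<-|Hw].
      - apply dep_weak with (2 := HM); intros z; apply box_mono; lia.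
      - apply dep_weak with (2 := IH w Hw); intros z; apply box_mono; lia. }
    destruct H as [N H]; exists N. intros p q Hpq. apply Hd; intros v Hv. now apply (H v Hv).
  - intros k; revert f Hf; induction k; intros f Hf.
    + split; auto. intros p eps He.
      destruct (jsmooth_support f Hf) as [l [_ Hd]].
      destruct (jsmooth_jcont f Hf (fun v => g v p) eps He) as [d [Hd0 H]].
      assert (G : exists d', 0 < d' /\ forall q, (forall v, Rabs (q v - p v) < d') ->
                 forall v, In v l -> Rabs (g v q - g v p) < d).
      { clear Hd; induction l as [|v l [d1 [Hd1 IH]]].
        - exists 1; split; [lra|]. intros q _ v [].
        - destruct (jsmooth_jcont _ (Hg v) p d Hd0) as [d2 [Hd2 H2]].
          exists (Rmin d1 d2); split; [apply Rmin_glb_lt; auto|].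
          intros q Hq w [<-|Hw].
          + apply H2; intros z; apply Rlt_le_trans with (1 := Hq z), Rmin_r.
          + apply IH; auto; intros z; apply Rlt_le_trans with (1 := Hq z), Rmin_l. }
      destruct G as [d' [Hd' G]]; exists d'; split; auto. intros q Hq.
      (* Outside the support [l] the coordinates are reset to their values at [p]: this does not
         affect [f] and yields closeness in every coordinate. *)
      unfold pull. rewrite (Hd (fun v => g v q) (fun v => if in_dec jvar_eq_dec v l then g v q else g v p)).
      * apply H. intros v; destruct in_dec; auto. now rewrite Rminus_eq_0, Rabs_R0.
      * intros v Hv; destruct in_dec; tauto.
    + repeat split.
      * eapply Cn_jcont; apply IHk, Hf.
      * intros v p; eexists; now apply is_derive_partial_pull.
      * intros v. destruct (jsmooth_support f Hf) as [l [Hl Hd]].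
        apply Cn_ext with (fun p => lsum l (fun w => partial v (g w) p * pull (partial w f) p)).
        { intros p. symmetry. apply partial_unique.
          generalize (is_derive_partial_pull f v p Hf). now rewrite (dir_lsum l). }
        apply Cn_lsum; intros w. apply Cn_mult.
        -- apply jsmooth_iff, jsmooth_partial, Hg.
        -- apply IHk, jsmooth_partial, Hf.
Qed.
End Composition.

(** * Total derivatives and primitives *)

Definition cx (v : jvar) : dfun := fun p =>
  match v with Vt => 0 | Vx => 1 | Vu i j => p (Vu i (S j)) end.

Definition ct (v : jvar) : dfun := fun p =>
  match v with Vt => 1 | Vx => 0 | Vu i j => p (Vu (S i) j) end.

Lemma jsmooth_cx v : jsmooth (cx v).
Proof. destruct v; [apply jsmooth_const|apply jsmooth_const|apply (jsmooth_coord (Vu i (S j)))]. Qed.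

Lemma jsmooth_ct v : jsmooth (ct v).
Proof. destruct v; [apply jsmooth_const|apply jsmooth_const|apply (jsmooth_coord (Vu (S i) j))]. Qed.

Lemma sum_f_R0_fold h N : fold_right (fun i a => h i + a) 0 (seq 0 (S N)) = sum_f_R0 h N.
Proof.
  assert (A : forall l b, fold_right (fun i a => h i + a) b l = fold_right (fun i a => h i + a) 0 l + b).
  { induction l; intros b; simpl; [ring|]. rewrite IHl; ring. }
  induction N; [simpl; ring|].
  rewrite seq_S, fold_right_app, A, IHN. simpl. ring.
Qed.

Lemma lsum_list_prod (h : jvar -> R) l l' :
  lsum (map (fun ij => Vu (fst ij) (snd ij)) (list_prod l l')) h =
  fold_right (fun i a => fold_right (fun j b => h (Vu i j) + b) 0 l' + a) 0 l.
Proof.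
  induction l as [|i l IH]; [reflexivity|].
  simpl. rewrite map_app, lsum_app, IH. f_equal.
  clear; induction l'; simpl; auto. now rewrite IHl'.
Qed.

Lemma lsum_sq h N :
  lsum (sq N) h = h Vt + (h Vx + sum_f_R0 (fun i => sum_f_R0 (fun j => h (Vu i j)) N) N).
Proof.
  unfold sq. simpl lsum at 1. do 2 f_equal.
  change (lsum (map (fun ij => Vu (fst ij) (snd ij)) (list_prod (seq 0 (S N)) (seq 0 (S N)))) h =
    sum_f_R0 (fun i => sum_f_R0 (fun j => h (Vu i j)) N) N).
  rewrite lsum_list_prod, <- sum_f_R0_fold.
  assert (A : forall l,
    fold_right (fun i a => fold_right (fun j b => h (Vu i j) + b) 0 (seq 0 (S N)) + a) 0 l =
    fold_right (fun i a => sum_f_R0 (fun j => h (Vu i j)) N + a) 0 l); [|apply A].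
  intros l; induction l; simpl fold_right; auto.
  rewrite <- IHl. f_equal. apply (sum_f_R0_fold (fun j => h (Vu a j))).
Qed.

Lemma dep_bound_spec f : jsmooth f -> dep (fun v => In v (sq (dep_bound f))) f.
Proof.
  intros [H _]. apply dep_weak with (box (dep_bound f)).
  - apply box_sq.
  - apply depends_le_dep. now apply (epsilon_spec (inhabits 0%nat) (fun N => depends_le f N)).
Qed.

(** The chosen order bound enters only as one possible support of [f], and disappears from all
    further computations. *)
Lemma Dx_X f : jsmooth f -> Dx f = X cx f.
Proof.
  intros Hf. rewrite (X_lsum (sq (dep_bound f))) by auto using sq_NoDup, dep_bound_spec.
  apply functional_extensionality; intros p. rewrite lsum_sq. unfold Dx, cx. ring.
Qed.

Lemma Dt_X f : jsmooth f -> Dt f = X ct f.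
Proof.
  intros Hf. rewrite (X_lsum (sq (dep_bound f))) by auto using sq_NoDup, dep_bound_spec.
  apply functional_extensionality; intros p. rewrite lsum_sq. unfold Dt, ct. ring.
Qed.

(** * Primitives with respect to one jet coordinate *)

Definition primitive (v : jvar) (f : dfun) : dfun := fun p => RInt (fun s => f (upd p v s)) 0 (p v).

(** Compactness of [a, b] turns the radii of continuity at the points [upd p v t] into a single
    radius; the integral over the segment then varies continuously. *)
Lemma jcont_upd_uniform f p v a b eps : jcont f -> 0 < eps ->
  exists d, 0 < d /\ forall q, (forall w, Rabs (q w - p w) < d) ->
    forall s, a <= s <= b -> Rabs (f (upd q v s) - f (upd p v s)) < eps.
Proof.
  intros Hf He.
  assert (H : forall t, exists d : posreal, forall q, (forall w, Rabs (q w - upd p v t w) < d) ->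
            Rabs (f q - f (upd p v t)) < eps / 2).
  { intros t. destruct (Hf (upd p v t) (eps / 2)) as [d [Hd H]]; [lra|].
    now exists (mkposreal d Hd). }
  destruct (choice _ H) as [delta Hdelta].
  destruct (compactness_value_1d a b delta) as [d Hd].
  exists d; split; [apply cond_pos|]. intros q Hq s Hs.
  destruct (NNPP _ (Hd s Hs)) as [t [Ht [Hst Hdt]]].
  assert (H1 : Rabs (f (upd q v s) - f (upd p v t)) < eps / 2).
  { apply Hdelta; intros w; unfold upd; destruct (jvar_eq_dec w v); auto.
    apply Rlt_le_trans with (1 := Hq w); auto. }
  assert (H2 : Rabs (f (upd p v s) - f (upd p v t)) < eps / 2).
  { apply Hdelta; intros w; unfold upd; destruct (jvar_eq_dec w v); auto.
    rewrite Rminus_eq_0, Rabs_R0; apply cond_pos. }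
  replace (f (upd q v s) - f (upd p v s)) with
    ((f (upd q v s) - f (upd p v t)) - (f (upd p v s) - f (upd p v t))) by ring.
  apply Rle_lt_trans with (1 := Rabs_triang _ _). rewrite Rabs_Ropp. lra.
Qed.

Lemma ex_RInt_upd f p v a b : jcont f -> ex_RInt (fun s => f (upd p v s)) a b.
Proof. intros Hf; apply (ex_RInt_continuous (V := R_CompleteNormedModule)); intros; now apply jcont_upd. Qed.

Lemma is_derive_primitive_self f p v : jcont f ->
  is_derive (fun b => RInt (fun s => f (upd p v s)) 0 b) (p v) (f p).
Proof.
  intros Hf. replace (f p) with (f (upd p v (p v))) by now rewrite upd_self.
  apply (is_derive_RInt (fun s => f (upd p v s)) (fun b => RInt (fun s => f (upd p v s)) 0 b) 0).
  - apply filter_forall; intros b. apply (RInt_correct (V := R_CompleteNormedModule)).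
    now apply ex_RInt_upd.
  - now apply jcont_upd.
Qed.

Lemma jcont_primitive v f : jcont f -> jcont (primitive v f).
Proof.
  intros Hf p eps He.
  (* [M] bounds the upper end point of integration for all [q] within distance 1 of [p]. *)
  set (M := Rabs (p v) + 1). assert (HM : 0 < M) by (unfold M; generalize (Rabs_pos (p v)); lra).
  assert (He1 : 0 < eps / 2 / M) by (apply Rdiv_lt_0_compat; lra).
  destruct (jcont_upd_uniform f p v (- M) M _ Hf He1) as [d1 [Hd1 H1]].
  assert (C : continuous (fun b => RInt (fun s => f (upd p v s)) 0 b) (p v)).
  { apply (ex_derive_continuous (fun b => RInt (fun s => f (upd p v s)) 0 b)).
    eexists; now apply is_derive_primitive_self. }
  assert (He2 : 0 < eps / 2) by lra.
  destruct (proj1 (filterlim_locally _ _) C (mkposreal _ He2)) as [d2 H2].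
  exists (Rmin 1 (Rmin d1 d2)). split.
  { repeat apply Rmin_glb_lt; auto; [lra|apply cond_pos]. }
  intros q Hq.
  assert (Hq1 : forall w, Rabs (q w - p w) < d1).
  { intros w. eapply Rlt_le_trans; [apply Hq|]. eapply Rle_trans; [apply Rmin_r|apply Rmin_l]. }
  assert (Hq2 : Rabs (q v - p v) < d2).
  { eapply Rlt_le_trans; [apply Hq|]. eapply Rle_trans; [apply Rmin_r|apply Rmin_r]. }
  assert (Hq3 : Rabs (q v) <= M).
  { unfold M. replace (q v) with (p v + (q v - p v)) by ring.
    apply Rle_trans with (1 := Rabs_triang _ _). apply Rplus_le_compat_l.
    left; eapply Rlt_le_trans; [apply Hq|apply Rmin_l]. }
  assert (I1 := ex_RInt_upd f q v 0 (q v) Hf). assert (I2 := ex_RInt_upd f p v 0 (q v) Hf).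
  assert (B1 : Rabs (RInt (fun s => f (upd q v s)) 0 (q v) - RInt (fun s => f (upd p v s)) 0 (q v))
     <= Rabs (q v - 0) * (eps / 2 / M)).
  { apply (norm_RInt_le_const_abs (V := R_NormedModule) (fun s => minus (f (upd q v s)) (f (upd p v s)))).
    - intros s Hs. left. apply (H1 q); auto.
      apply Rabs_le_between in Hq3. destruct (Rle_dec 0 (q v)).
      + rewrite Rmin_left, Rmax_right in Hs by lra. lra.
      + rewrite Rmin_right, Rmax_left in Hs by lra. lra.
    - apply (is_RInt_minus (V := R_NormedModule)); apply (RInt_correct (V := R_CompleteNormedModule)); auto. }
  assert (B2 : Rabs (RInt (fun s => f (upd p v s)) 0 (q v) - RInt (fun s => f (upd p v s)) 0 (p v)) < eps / 2)
    by exact (H2 (q v) Hq2).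
  assert (B3 : Rabs (q v - 0) * (eps / 2 / M) <= eps / 2).
  { rewrite Rminus_0_r. apply Rle_trans with (M * (eps / 2 / M)); [|right; field; lra].
    apply Rmult_le_compat_r; lra. }
  unfold primitive.
  replace (RInt (fun s => f (upd q v s)) 0 (q v) - RInt (fun s => f (upd p v s)) 0 (p v)) with
   ((RInt (fun s => f (upd q v s)) 0 (q v) - RInt (fun s => f (upd p v s)) 0 (q v)) +
    (RInt (fun s => f (upd p v s)) 0 (q v) - RInt (fun s => f (upd p v s)) 0 (p v))) by ring.
  apply Rle_lt_trans with (1 := Rabs_triang _ _). lra.
Qed.

(** Along [v] this is the fundamental theorem of calculus, along any other coordinate
    differentiation under the integral sign. *)
Lemma is_derive_primitive f v w p : Cn 1 f ->
  is_derive (fun s => primitive v f (upd p w s)) (p w)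
    (if jvar_eq_dec w v then f p else primitive v (partial w f) p).
Proof.
  intros [Hf [Hd Hp]]. destruct (jvar_eq_dec w v) as [->|n].
  - apply is_derive_ext with (2 := is_derive_primitive_self f p v Hf).
    intros b; unfold primitive. rewrite upd_same. apply RInt_ext; intros; now rewrite upd_upd.
  - assert (E : primitive v (partial w f) p =
      RInt (fun t => Derive (fun u => f (upd (upd p w u) v t)) (p w)) 0 (p v)).
    { unfold primitive; apply RInt_ext; intros t _. unfold partial. rewrite upd_other by auto.
      apply Derive_ext; intros; now rewrite upd_comm. }
    rewrite E.
    assert (D : forall u t, is_derive (fun u => f (upd (upd p w u) v t)) u
      (partial w f (upd (upd p w u) v t))).
    { intros u t. rewrite (upd_comm p) by auto.
      apply is_derive_ext with (fun u => f (upd (upd p v t) w u)).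
      - intros; now rewrite upd_comm by auto.
      - now apply is_partial. }
    apply is_derive_ext with (fun s => RInt (fun t => f (upd (upd p w s) v t)) 0 (p v)).
    { intros s; unfold primitive. now rewrite upd_other by auto. }
    apply (is_derive_RInt_param (fun u t => f (upd (upd p w u) v t))).
    + apply filter_forall; intros u t _. eexists; apply D.
    + intros t _. apply continuity_2d_pt_ext with (fun u t => partial w f (upd (upd p w u) v t)).
      { intros x y. symmetry; apply is_derive_unique, D. }
      apply jcont_upd2; auto. apply (Hp w).
    + apply filter_forall; intros u. now apply ex_RInt_upd.
Qed.

Lemma partial_primitive v f : jsmooth f -> partial v (primitive v f) = f.
Proof.
  intros Hf; apply functional_extensionality; intros p.
  apply partial_unique.
  generalize (is_derive_primitive f v v p (proj2 (proj1 (jsmooth_iff f) Hf) 1%nat)).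
  destruct (jvar_eq_dec v v); [auto|congruence].
Qed.

Lemma dep_primitive P v f : dep P f -> dep (fun w => P w \/ w = v) (primitive v f).
Proof.
  intros Hf p q H. unfold primitive. rewrite (H v) by auto. apply RInt_ext; intros s _.
  apply Hf; intros w Pw; unfold upd; destruct (jvar_eq_dec w v); auto.
Qed.

Lemma jsmooth_primitive v f : jsmooth f -> jsmooth (primitive v f).
Proof.
  intros Hf. apply jsmooth_iff; split.
  - destruct (dep2 f (fun p => p v)) as [N [H H']];
      [apply jsmooth_iff, Hf|apply jsmooth_iff, jsmooth_coord|].
    exists N. intros p q Hpq. apply (dep_primitive (box N) v f H). intros w [Hw| ->]; auto.
  - intros k; revert f Hf; induction k; intros f Hf.
    + split; auto. apply jcont_primitive, jsmooth_jcont, Hf.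
    + assert (H := proj2 (proj1 (jsmooth_iff f) Hf)). repeat split.
      * apply jcont_primitive, jsmooth_jcont, Hf.
      * intros w p; eexists; apply is_derive_primitive, H.
      * intros w. apply Cn_ext with (if jvar_eq_dec w v then f else primitive v (partial w f)).
        { intros p; symmetry; apply partial_unique.
          generalize (is_derive_primitive f v w p (H 1%nat)). destruct (jvar_eq_dec w v); auto. }
        destruct (jvar_eq_dec w v); [apply H|]. apply IHk, jsmooth_partial, Hf.
Qed.

Lemma const_along f v p a b : pdiff f -> (forall q, partial v f q = 0) ->
  f (upd p v a) = f (upd p v b).
Proof.
  intros Hf H.
  assert (D : forall t, is_derive (fun s => f (upd p v s)) t zero).
  { intros t. generalize (is_partial f p v t Hf). now rewrite H. }
  destruct (Rtotal_order a b) as [h|[->|h]]; auto.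
  - apply (eq_is_derive (fun s => f (upd p v s))); auto.
  - symmetry; apply (eq_is_derive (fun s => f (upd p v s))); auto.
Qed.

(** Moving the coordinate [v] of [p] to its value in [q] leaves [f] unchanged, after which the two
    points agree on [P]. Every lowering of an order goes through this. *)
Lemma dep_drop (P Q : jvar -> Prop) f v : pdiff f -> dep P f -> (forall q, partial v f q = 0) ->
  (forall w, P w -> w = v \/ Q w) -> dep Q f.
Proof.
  intros Hf Hd H PQ p q Hpq.
  rewrite <- (upd_self p v), (const_along f v p (p v) (q v) Hf H).
  apply Hd; intros w Pw. unfold upd; destruct (jvar_eq_dec w v); [now subst|].
  destruct (PQ w Pw); [congruence|auto].
Qed.

(** * The solution manifold *)

(** These are the free coordinates on the solution set, up to order [n]. *)
Definition red (n : nat) (v : jvar) : Prop :=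
  match v with Vu i j => i = O /\ (j <= n)%nat | _ => True end.

Definition base (v : jvar) : Prop := match v with Vu _ _ => False | _ => True end.

(** Grading by the number of t-derivatives, along which the coordinates of a solution point are
    determined one after another. *)
Definition rows (n : nat) (v : jvar) : Prop :=
  match v with Vu i _ => (i <= n)%nat | _ => True end.

Lemma red_mono n m v : (n <= m)%nat -> red n v -> red m v.
Proof. destruct v; simpl; intuition lia. Qed.

Lemma dep_red_mono n m f : (n <= m)%nat -> dep (red n) f -> dep (red m) f.
Proof. intros H; apply dep_weak; intros v; now apply red_mono. Qed.

Lemma base_red n f : dep base f -> dep (red n) f.
Proof. apply dep_weak; intros [| |i j]; simpl; tauto. Qed.

Lemma dir_zero f p : dir f p (fun _ => 0) = 0.
Proof.
  unfold dir. rewrite (Derive_ext _ (fun _ => f p)); [apply Derive_const|].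
  intros t; f_equal; apply functional_extensionality; intros; ring.
Qed.

Lemma dir_zero_on P f p w : dep P f -> (forall v, P v -> w v = 0) -> dir f p w = 0.
Proof. intros Hf H. rewrite (dir_ext P f p w (fun _ => 0)) by auto. apply dir_zero. Qed.

Lemma jsmooth_iterX c n f : (forall v, jsmooth (c v)) -> jsmooth f -> jsmooth (iterD (X c) n f).
Proof. intros Hc Hf; induction n; simpl; auto using jsmooth_X. Qed.

Lemma iterX_minus c n f g : (forall v, jsmooth (c v)) -> jsmooth f -> jsmooth g ->
  iterD (X c) n (fun p => f p - g p) = fun p => iterD (X c) n f p - iterD (X c) n g p.
Proof.
  intros Hc Hf Hg; induction n; simpl; auto.
  rewrite IHn, X_minus; auto using jsmooth_iterX.
Qed.

Lemma iterD_Dx n f : jsmooth f -> iterD Dx n f = iterD (X cx) n f.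
Proof.
  intros Hf; induction n; simpl; auto. rewrite IHn.
  apply Dx_X, jsmooth_iterX; auto using jsmooth_cx.
Qed.

Lemma iterD_Dt n f : jsmooth f -> iterD Dt n f = iterD (X ct) n f.
Proof.
  intros Hf; induction n; simpl; auto. rewrite IHn.
  apply Dt_X, jsmooth_iterX; auto using jsmooth_ct.
Qed.

Lemma dep_Dx_red n f : dep (red n) f -> dep (red (S n)) (X cx f).
Proof.
  intros Hf. apply (dep_X (red n)); auto.
  - intros v; apply red_mono; lia.
  - intros [| |i j] Hv; simpl in *; [apply dep_const|apply dep_const|].
    apply (dep_coord _ (Vu i (S j))). simpl; lia.
Qed.

Lemma X_cx_base f p : dep base f -> X cx f p = dir f p (dl Vx).
Proof. intros Hf; apply (dir_ext base); auto. intros [| |i j]; simpl; tauto. Qed.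

(** * The evolution field and the solution set as a graph *)

Section Evolution.
Variables A B : R -> R.
Hypothesis HAB : in_class A B.

(** The equation solved for u_t. The square is written as a product so that the Leibniz rule for [X]
    applies directly. *)
Definition evol : dfun := fun p =>
  A (uu p) * p (Vu 0 2) + Derive A (uu p) * (ux p * ux p) + B (uu p) * ux p.

Lemma jsmooth_uu : jsmooth uu.
Proof. apply (jsmooth_coord (Vu 0 0)). Qed.

Lemma jsmooth_ux : jsmooth ux.
Proof. apply (jsmooth_coord (Vu 0 1)). Qed.

Lemma jsmooth_fu a : smooth1 a -> jsmooth (fun p => a (uu p)).
Proof. intros; apply jsmooth_comp1; auto using jsmooth_uu. Qed.

Lemma jsmooth_evol : jsmooth evol.
Proof.
  destruct HAB as [HA [HB _]].
  repeat (apply jsmooth_plus || apply jsmooth_mult); auto using jsmooth_fu, jsmooth_ux, smooth1_Derive.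
  apply (jsmooth_coord (Vu 0 2)).
Qed.

Lemma eqn_evol : eqn A B = fun p => p (Vu 1 0) - evol p.
Proof. apply functional_extensionality; intros p; unfold eqn, evol; ring. Qed.

Lemma jsmooth_eqn : jsmooth (eqn A B).
Proof.
  rewrite eqn_evol. apply jsmooth_minus; [apply (jsmooth_coord (Vu 1 0))|apply jsmooth_evol].
Qed.

Lemma dep_evol : dep (red 2) evol.
Proof.
  intros p q H. unfold evol, uu, ux.
  rewrite (H (Vu 0 0)), (H (Vu 0 1)), (H (Vu 0 2)); simpl; auto.
Qed.

Definition Ej (j : nat) : dfun := iterD (X cx) j evol.

Lemma jsmooth_Ej j : jsmooth (Ej j).
Proof. apply jsmooth_iterX; auto using jsmooth_cx, jsmooth_evol. Qed.

Lemma dep_Ej j : dep (red (j + 2)) (Ej j).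
Proof. induction j; simpl; [apply dep_evol|]. now apply dep_Dx_red. Qed.

(* On functions of t, x and the x-derivatives of u, [X cT] is the total t-derivative
   with every t-derivative of u eliminated by means of the equation. *)
Definition cT (v : jvar) : dfun :=
  match v with
  | Vt => fun _ => 1 | Vx => fun _ => 0 | Vu O j => Ej j | Vu (S _) _ => fun _ => 0
  end.

Lemma jsmooth_cT v : jsmooth (cT v).
Proof. destruct v as [| |[|i] j]; simpl; auto using jsmooth_const, jsmooth_Ej. Qed.

Lemma dep_T_red n f : dep (red n) f -> dep (red (n + 2)) (X cT f).
Proof.
  intros Hf. apply (dep_X (red n)); auto.
  - intros v; apply red_mono; lia.
  - intros [| |[|i] j] Hv; simpl in *; auto using dep_const.
    apply dep_red_mono with (2 := dep_Ej j). lia.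
Qed.

(** All components of the bracket vanish: on x-derivatives of u because [Ej (S j)] is D of [Ej j],
    on coordinates with t-derivatives because T freezes them. *)
Lemma cx_cT_comm f : jsmooth f -> X cx (X cT f) = X cT (X cx f).
Proof.
  intros Hf; apply functional_extensionality; intros p.
  rewrite X_comm by auto using jsmooth_cx, jsmooth_cT.
  rewrite (dir_zero_on (fun _ => True)); [ring| |].
  - intros q r H; f_equal; apply functional_extensionality; auto.
  - intros [| |[|i] j] _; unfold cT, cx at 2.
    + rewrite 2!X_const; ring.
    + rewrite 2!X_const; ring.
    + rewrite X_coord. simpl. unfold Ej; simpl. ring.
    + rewrite X_coord, X_const. simpl. ring.
Qed.

Definition K (v : jvar) : dfun :=
  match v with
  | Vt => fun p => p Vt | Vx => fun p => p Vx
  | Vu i j => iterD (X cT) i (fun p => p (Vu 0 j))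
  end.

(* The point of the solution manifold with the same t, x and x-derivatives of u. *)
Definition Kp (p : jpt) : jpt := fun v => K v p.

Lemma jsmooth_K v : jsmooth (K v).
Proof.
  destruct v as [| |i j]; simpl; [apply (jsmooth_coord Vt)|apply (jsmooth_coord Vx)|].
  apply jsmooth_iterX; [apply jsmooth_cT|apply (jsmooth_coord (Vu 0 j))].
Qed.

(** Geometrically, [cT] is [Kp]-related to [ct]: one more t-derivative is one more application of
    T. *)
Lemma X_cT_K v p : X cT (K v) p = ct v (Kp p).
Proof. destruct v; simpl; [now rewrite X_coord|now rewrite X_coord|reflexivity]. Qed.

(** Likewise [cx] is [Kp]-related to itself; D has to be moved past T^i, which is where commutation
    of D and T is needed. *)
Lemma X_cx_K v p : X cx (K v) p = cx v (Kp p).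
Proof.
  destruct v as [| |i j]; simpl; [now rewrite X_coord|now rewrite X_coord|].
  assert (E : X cx (iterD (X cT) i (fun q => q (Vu 0 j))) = iterD (X cT) i (fun q => q (Vu 0 (S j)))).
  { induction i; simpl; [now rewrite X_coord|].
    rewrite cx_cT_comm, IHi; auto.
    apply jsmooth_iterX; [apply jsmooth_cT|apply (jsmooth_coord (Vu 0 j))]. }
  now rewrite E.
Qed.

Definition pullK (f : dfun) : dfun := fun p => f (Kp p).

Lemma jsmooth_pullK f : jsmooth f -> jsmooth (pullK f).
Proof. exact (jsmooth_pull K jsmooth_K f). Qed.

Lemma pullK_Dx f : jsmooth f -> pullK (X cx f) = X cx (pullK f).
Proof.
  intros Hf; apply functional_extensionality; intros p.
  rewrite (X_pull K jsmooth_K cx f) by auto. unfold pullK, X at 1. f_equal.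
  apply functional_extensionality; intros v; now rewrite X_cx_K.
Qed.

Lemma pullK_Dt f : jsmooth f -> pullK (X ct f) = X cT (pullK f).
Proof.
  intros Hf; apply functional_extensionality; intros p.
  rewrite (X_pull K jsmooth_K cT f) by auto. unfold pullK, X at 1. f_equal.
  apply functional_extensionality; intros v; now rewrite X_cT_K.
Qed.

Lemma pullK_red n f : dep (red n) f -> pullK f = f.
Proof.
  intros Hf; apply functional_extensionality; intros p. apply Hf.
  intros [| |i j] Hv; simpl in *; auto. destruct Hv as [-> _]; auto.
Qed.

Lemma pullK_red_ex f : jsmooth f -> exists n, dep (red n) (pullK f).
Proof.
  intros Hf. destruct (proj1 (proj1 (jsmooth_iff f) Hf)) as [N HN].
  (* The equation is of second order in x, so u_ij pulls back to a function of order at most j +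
     2i. *)
  exists (N + 2 * N)%nat. intros p q H. apply HN. intros [| |i j] Hv; simpl in Hv.
  - now apply (H Vt).
  - now apply (H Vx).
  - assert (G : dep (red (j + 2 * i)) (iterD (X cT) i (fun p => p (Vu 0 j)))).
    { clear; induction i; simpl.
      - apply (dep_coord _ (Vu 0 j)); simpl; lia.
      - apply dep_red_mono with (2 := dep_T_red _ _ IHi); lia. }
    apply G. intros v Hv'; apply H. revert Hv'; apply red_mono; lia.
Qed.

Lemma iterX_zero c n : iterD (X c) n (fun _ => 0) = fun _ => 0.
Proof. induction n; simpl; auto. rewrite IHn; apply X_const. Qed.

(** The equation itself pulls back to 0, and pullback turns D_x and D_t into D and T, which map 0 to
    0. *)
Lemma sol_Kp p : sol A B (Kp p).
Proof.
  intros i j. rewrite iterD_Dx by apply jsmooth_eqn.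
  assert (S := jsmooth_iterX cx j _ jsmooth_cx jsmooth_eqn).
  rewrite iterD_Dt by auto.
  assert (E0 : pullK (eqn A B) = fun _ => 0).
  { apply functional_extensionality; intros q. rewrite eqn_evol. unfold pullK.
    change (evol (Kp q)) with (pullK evol q).
    rewrite (pullK_red 2 evol dep_evol). unfold Kp; simpl. rewrite X_coord.
    unfold cT, Ej; simpl. ring. }
  assert (E1 : pullK (iterD (X cx) j (eqn A B)) = fun _ => 0).
  { rewrite <- (iterX_zero cx j), <- E0. generalize jsmooth_eqn. generalize (eqn A B).
    clear -HAB; intros g Hg; induction j; simpl; auto.
    rewrite pullK_Dx by (apply jsmooth_iterX; auto using jsmooth_cx). now rewrite IHj. }
  revert S E1. generalize (iterD (X cx) j (eqn A B)). clear -HAB; intros g Hg E1.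
  change (pullK (iterD (X ct) i g) p = 0).
  assert (E2 : pullK (iterD (X ct) i g) = fun _ => 0); [|now rewrite E2].
  rewrite <- (iterX_zero cT i), <- E1. induction i; simpl; auto.
  rewrite pullK_Dt by (apply jsmooth_iterX; auto using jsmooth_ct). now rewrite IHi.
Qed.

Lemma iterX_coord_x j a i : iterD (X cx) j (fun p => p (Vu i a)) = fun p => p (Vu i (j + a)).
Proof. induction j; simpl; auto. rewrite IHj. now rewrite X_coord. Qed.

Lemma iterX_coord_t i a j : iterD (X ct) i (fun p => p (Vu a j)) = fun p => p (Vu (i + a) j).
Proof. induction i; simpl; auto. rewrite IHi. now rewrite X_coord. Qed.

(** Each differential consequence is thereby solved for u_{i+1,j}; the remainder contains at most i
    t-derivatives. *)
Lemma eqn_ij i j p : iterD Dt i (iterD Dx j (eqn A B)) p =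
  p (Vu (S i) j) - iterD (X ct) i (Ej j) p.
Proof.
  rewrite iterD_Dx by apply jsmooth_eqn.
  rewrite iterD_Dt by (apply jsmooth_iterX; auto using jsmooth_cx, jsmooth_eqn).
  rewrite eqn_evol.
  rewrite (iterX_minus cx j (fun p => p (Vu 1 0)) evol);
    [|apply jsmooth_cx|apply (jsmooth_coord (Vu 1 0))|apply jsmooth_evol].
  fold (Ej j). rewrite iterX_coord_x, Nat.add_0_r.
  rewrite (iterX_minus ct i (fun p => p (Vu 1 j)) (Ej j));
    [|apply jsmooth_ct|apply (jsmooth_coord (Vu 1 j))|apply jsmooth_Ej].
  rewrite iterX_coord_t. now rewrite Nat.add_1_r.
Qed.

Lemma dep_Dt_rows i f : dep (rows i) f -> dep (rows (S i)) (X ct f).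
Proof.
  intros Hf. apply (dep_X (rows i)); auto.
  - intros [| |a b]; simpl; auto.
  - intros [| |a b] Hv; simpl in *; [apply dep_const|apply dep_const|].
    apply (dep_coord _ (Vu (S a) b)). simpl; lia.
Qed.

(** Both [p] and [Kp p] satisfy all consequences, and these express row n + 1 through the rows up to
    n, so agreement propagates from row 0 upwards. *)
Lemma sol_eq_Kp p : sol A B p -> p = Kp p.
Proof.
  intros Hp. assert (H : forall n v, rows n v -> p v = Kp p v).
  { induction n as [|n IH]; intros [| |i j] Hv; auto; simpl in Hv.
    - replace i with O by lia; reflexivity.
    - destruct (Nat.eq_dec i (S n)) as [->|ne]; [|apply IH; simpl; lia].
      assert (E1 := Hp n j). assert (E2 := sol_Kp p n j). rewrite eqn_ij in E1, E2.
      assert (D : dep (rows n) (iterD (X ct) n (Ej j))).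
      { clear; induction n; simpl.
        - apply dep_weak with (2 := dep_Ej j). intros [| |a b]; simpl; lia.
        - now apply dep_Dt_rows. }
      rewrite (D p (Kp p)) in E1 by exact IH. lra. }
  apply functional_extensionality; intros v.
  apply (H (match v with Vu i _ => i | _ => O end)). destruct v; simpl; auto.
Qed.
End Evolution.

(** * Reduction of the order of a conserved density *)

(** The coordinate derivative rewritten as a constant vector field, so that its commutators with D
    and T are instances of the bracket formula. *)
Definition pd (w : jvar) : dfun -> dfun := X (fun v _ => dl w v).
Notation P k := (pd (Vu 0 k)).

Lemma partial_pd w f : jsmooth f -> partial w f = pd w f.
Proof. intros Hf; apply functional_extensionality; intros p; now apply partial_dir. Qed.

Lemma jsmooth_pd w f : jsmooth f -> jsmooth (pd w f).
Proof. intros Hf; apply jsmooth_X; auto using jsmooth_const. Qed.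

Lemma dep_pd Q w f : dep Q f -> dep Q (pd w f).
Proof. intros Hf; apply (dep_X Q); auto using dep_const. Qed.

Lemma dl_same v : dl v v = 1.
Proof. unfold dl; destruct (jvar_eq_dec v v); congruence. Qed.

Lemma dl_diff v w : w <> v -> dl v w = 0.
Proof. intros n; unfold dl; destruct (jvar_eq_dec w v); congruence. Qed.

Lemma pd_out Q w f : dep Q f -> ~ Q w -> pd w f = fun _ => 0.
Proof.
  intros Hf Hw; apply functional_extensionality; intros p.
  apply (dir_zero_on Q); auto. intros v Hv; apply dl_diff; congruence.
Qed.

Lemma pd_drop (Q Q' : jvar -> Prop) w f : jsmooth f -> dep Q f -> pd w f = (fun _ => 0) ->
  (forall v, Q v -> v = w \/ Q' v) -> dep Q' f.
Proof.
  intros Hf Hd H. apply dep_drop; auto using jsmooth_pdiff.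
  intros q; now rewrite partial_pd, H.
Qed.

Lemma red_S n v : red (S n) v -> v = Vu 0 (S n) \/ red n v.
Proof.
  destruct v as [| |i j]; simpl; auto. intros [-> H].
  destruct (Nat.eq_dec j (S n)) as [->|]; [auto|right; lia].
Qed.

Lemma red_0 v : red 0 v -> v = Vu 0 0 \/ base v.
Proof. destruct v as [| |i j]; simpl; auto. intros [-> H]. replace j with O by lia; auto. Qed.

Lemma pd_comm v w f : jsmooth f -> pd v (pd w f) = pd w (pd v f).
Proof.
  intros Hf; apply functional_extensionality; intros p. unfold pd.
  rewrite X_comm by auto using jsmooth_const.
  rewrite (dir_zero_on (fun _ => True)); [ring| |].
  - intros q r H; f_equal; apply functional_extensionality; auto.
  - intros z _. rewrite 2!X_const; ring.
Qed.

Lemma pd_X w c f p : jsmooth f -> (forall v, jsmooth (c v)) ->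
  pd w (X c f) p = X c (pd w f) p + dir f p (fun v => pd w (c v) p).
Proof.
  intros Hf Hc. unfold pd. rewrite X_comm by auto using jsmooth_const. do 2 f_equal.
  apply functional_extensionality; intros v. rewrite X_const; ring.
Qed.

Lemma pd_cx w v p : pd w (cx v) p = match v with Vu i j => dl w (Vu i (S j)) | _ => 0 end.
Proof.
  destruct v as [| |i j]; unfold pd, cx; [now rewrite X_const|now rewrite X_const|].
  now rewrite X_coord.
Qed.

(** This is [d/du_{k+1}, D] = d/du_k: among the components of D only the one at u_k involves
    u_{k+1}. All order counts below rest on it. *)
Lemma pd_D_S k f : jsmooth f -> P (S k) (X cx f) = fun p => X cx (P (S k) f) p + P k f p.
Proof.
  intros Hf; apply functional_extensionality; intros p.
  rewrite pd_X by auto using jsmooth_cx. f_equal.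
  change (P k f p) with (dir f p (dl (Vu 0 k))). f_equal.
  apply functional_extensionality; intros v. rewrite pd_cx.
  destruct v as [| |i j]; unfold dl; repeat destruct jvar_eq_dec; congruence.
Qed.

Lemma pd_D_0 f : jsmooth f -> P 0 (X cx f) = X cx (P 0 f).
Proof.
  intros Hf; apply functional_extensionality; intros p.
  rewrite pd_X by auto using jsmooth_cx.
  rewrite (dir_zero_on (fun _ => True)); [ring| |].
  - intros q r H; f_equal; apply functional_extensionality; auto.
  - intros v _. rewrite pd_cx. destruct v; auto. apply dl_diff; discriminate.
Qed.

Lemma X_uu c : X c uu = c (Vu 0 0)%nat.
Proof. apply (X_coord c (Vu 0 0)). Qed.

Lemma X_ux c : X c ux = c (Vu 0 1)%nat.
Proof. apply (X_coord c (Vu 0 1)). Qed.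

Lemma dep_fu (Q : jvar -> Prop) (a : R -> R) : Q (Vu 0 0) -> dep Q (fun p => a (uu p)).
Proof. intros HQ; apply dep_comp1. now apply (dep_coord Q (Vu 0 0)). Qed.

Lemma X_fu c a : smooth1 a -> X c (fun p => a (uu p)) = fun p => Derive a (uu p) * c (Vu 0 0) p.
Proof. intros Ha. rewrite X_comp1, X_uu by auto using jsmooth_uu. reflexivity. Qed.

(* A total x-derivative [X cx G] of a function of order at least 1 has higher order than [G]. *)
Lemma Dx_order_zero n G : jsmooth G -> dep (red n) G -> dep (red 0) (X cx G) -> dep base G.
Proof.
  intros HG Hd H0. assert (H : dep (red 0) G).
  { induction n as [|n IH]; auto. apply IH.
    apply (pd_drop (red (S n)) _ (Vu 0 (S n))); auto using red_S.
    (* The u_{n+2}-derivative of D G is the u_{n+1}-derivative of G, as G has order at most n + 1;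
       it vanishes because D G has order 0. *)
    assert (E := pd_D_S (S n) G HG).
    rewrite (pd_out (red 0) _ (X cx G)), (pd_out (red (S n)) _ G), X_const in E; auto.
    - rewrite E at 1. apply functional_extensionality; intros; ring.
    - simpl; lia.
    - simpl; lia. }
  apply (pd_drop (red 0) _ (Vu 0 0)); auto using red_0.
  assert (E := pd_D_S 0 G HG).
  rewrite (pd_out (red 0) _ (X cx G)), (pd_out (red 0) _ G), X_const in E; auto.
  - rewrite E at 1. apply functional_extensionality; intros; ring.
  - simpl; lia.
  - simpl; lia.
Qed.

Section Reduction.
Variables A B : R -> R.
Hypothesis HAB : in_class A B.
Let HA : smooth1 A. Proof. apply HAB. Qed.
Let HB : smooth1 B. Proof. apply HAB. Qed.
Notation T := (X (cT A B)).
Notation D := (X cx).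
Notation E := (Ej A B).
Let cTs := jsmooth_cT A B HAB.

(** * Leading coefficients of D^j u_t and of T F *)

Lemma X_evol c : X c (evol A B) = fun p =>
  Derive A (uu p) * c (Vu 0 0)%nat p * p (Vu 0 2) + A (uu p) * c (Vu 0 2)%nat p
  + (Derive (Derive A) (uu p) * c (Vu 0 0)%nat p * (ux p * ux p)
     + Derive A (uu p) * (2 * ux p * c (Vu 0 1)%nat p))
  + (Derive B (uu p) * c (Vu 0 0)%nat p * ux p + B (uu p) * c (Vu 0 1)%nat p).
Proof.
  assert (HA' := smooth1_Derive A HA).
  assert (j1 := jsmooth_fu A HA). assert (j2 := jsmooth_fu B HB).
  assert (j3 := jsmooth_fu _ HA'). assert (j4 := jsmooth_ux).
  assert (j5 := jsmooth_coord (Vu 0 2)). assert (j6 := jsmooth_mult _ _ j4 j4).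
  assert (k1 := jsmooth_mult _ _ j1 j5). assert (k2 := jsmooth_mult _ _ j3 j6).
  assert (k3 := jsmooth_mult _ _ j2 j4).
  unfold evol.
  rewrite (X_plus c (fun p => A (uu p) * p (Vu 0 2) + Derive A (uu p) * (ux p * ux p))
    (fun p => B (uu p) * ux p)) by auto using jsmooth_plus.
  rewrite (X_plus c (fun p => A (uu p) * p (Vu 0 2)) (fun p => Derive A (uu p) * (ux p * ux p))) by auto.
  rewrite (X_mult c (fun p => A (uu p)) (fun p => p (Vu 0 2))) by auto.
  rewrite (X_mult c (fun p => Derive A (uu p)) (fun p => ux p * ux p)) by auto.
  rewrite (X_mult c ux ux) by auto.
  rewrite (X_mult c (fun p => B (uu p)) ux) by auto.
  rewrite !X_fu, X_ux, X_coord by auto.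
  apply functional_extensionality; intros p; ring.
Qed.

Lemma pd_E_top j : P (j + 2) (E j) = fun p => A (uu p).
Proof.
  induction j.
  - simpl. unfold Ej; simpl. unfold pd; rewrite X_evol.
    apply functional_extensionality; intros p.
    rewrite dl_same, !dl_diff by discriminate. ring.
  - change (E (S j)) with (D (E j)). change (S j + 2)%nat with (S (j + 2)).
    rewrite pd_D_S by auto using jsmooth_Ej. rewrite IHj.
    rewrite (pd_out (red (j + 2)) _ (E j)), X_const by (try apply dep_Ej; simpl; lia).
    apply functional_extensionality; intros; ring.
Qed.

Lemma pd_evol_1 : P 1 (evol A B) = fun p => 2 * Derive A (uu p) * ux p + B (uu p).
Proof.
  unfold pd; rewrite X_evol.
  apply functional_extensionality; intros p.
  rewrite dl_same, !dl_diff by discriminate. ring.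
Qed.

(** Each application of D adds D(A(u)) = A'(u) u_x, coming from the top coefficient, to the initial
    2 A'(u) u_x + B(u). *)
Lemma pd_E_next j : P (j + 1) (E j) =
  fun p => (INR j + 2) * Derive A (uu p) * ux p + B (uu p).
Proof.
  induction j.
  - simpl. unfold Ej; simpl. rewrite pd_evol_1. apply functional_extensionality; intros p; ring.
  - change (E (S j)) with (D (E j)). change (S j + 1)%nat with (S (j + 1)).
    rewrite pd_D_S by auto using jsmooth_Ej. rewrite IHj.
    replace (S (j + 1)) with (j + 2)%nat by lia. rewrite pd_E_top, X_fu by auto.
    apply functional_extensionality; intros p; rewrite S_INR; unfold cx, ux; ring.
Qed.

(** The coefficient (j + 2) A'(u) u_x + B(u) involves u_{j+1} only when j = 0. Both sides are 2
    A'(u) for j = 0 and vanish otherwise, so this form avoids a case distinction later. *)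
Lemma pd_E_next2 j : P (j + 1) (P (j + 1) (E j)) = fun p => 2 * P j (fun q => A (uu q)) p.
Proof.
  rewrite pd_E_next.
  assert (HA' := smooth1_Derive A HA).
  assert (j3 := jsmooth_fu _ HA'). assert (j4 := jsmooth_ux). assert (j0 := jsmooth_const (INR j + 2)).
  assert (k1 := jsmooth_mult _ _ j0 j3).
  unfold pd.
  rewrite (X_plus _ (fun p => (INR j + 2) * Derive A (uu p) * ux p) (fun p => B (uu p)))
    by auto using jsmooth_mult, jsmooth_fu.
  rewrite (X_mult _ (fun p => (INR j + 2) * Derive A (uu p)) ux) by auto.
  rewrite (X_scal _ (INR j + 2) (fun p => Derive A (uu p))) by auto.
  rewrite !X_fu, X_ux by auto.
  apply functional_extensionality; intros p.
  rewrite (dl_diff _ (Vu 0 0)) by (rewrite Nat.add_1_r; discriminate).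
  destruct j as [|j].
  - simpl. rewrite !dl_same. ring.
  - rewrite (dl_diff _ (Vu 0 1)), (dl_diff _ (Vu 0 0)) by (intros e; injection e; lia). ring.
Qed.

Lemma pd_T k F p : jsmooth F ->
  P k (T F) p = T (P k F) p + dir F p (fun v => P k (cT A B v) p).
Proof. intros; now apply pd_X. Qed.

(** In T F = F_t + sum of E_j F_{u_j} only E_n reaches order n + 2. *)
Lemma pd_T_top n F : jsmooth F -> dep (red n) F ->
  P (n + 2) (T F) = fun p => A (uu p) * P n F p.
Proof.
  intros HF Hd; apply functional_extensionality; intros p.
  rewrite pd_T by auto.
  rewrite (pd_out (red n) _ F), X_const by (auto; simpl; lia).
  unfold pd at 2, X. rewrite <- dir_scal by auto. rewrite Rplus_0_l.
  apply (dir_ext (red n)); auto.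
  intros [| |i j] Hv; simpl in Hv; unfold cT.
  - rewrite dl_diff by discriminate. unfold pd; rewrite X_const; ring.
  - rewrite dl_diff by discriminate. unfold pd; rewrite X_const; ring.
  - destruct Hv as [-> Hj]. destruct (Nat.eq_dec j n) as [->|ne].
    + rewrite dl_same, pd_E_top. ring.
    + rewrite dl_diff by congruence. rewrite (pd_out (red (j + 2))) by (try apply dep_Ej; simpl; lia). ring.
Qed.

(** Only the term E_n F_{u_n} survives two u_{n+1}-derivatives: E_{n-1} is linear in u_{n+1} with
    coefficient A(u), and the earlier E_j have order at most n. *)
Lemma pd_T_second n F : jsmooth F -> dep (red n) F ->
  P (n + 1) (P (n + 1) (T F)) = fun p => 2 * P n (fun q => A (uu q)) p * P n F p.
Proof.
  intros HF Hd.
  set (W := fun v => P (n + 1) (cT A B v)).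
  assert (E1 : P (n + 1) (T F) = X W F).
  { apply functional_extensionality; intros p.
    rewrite pd_T by auto.
    rewrite (pd_out (red n) _ F), X_const by (auto; simpl; lia). apply Rplus_0_l. }
  rewrite E1. apply functional_extensionality; intros p.
  rewrite pd_X by (auto; intros v; now apply jsmooth_pd).
  rewrite (pd_out (red n) _ F), X_const by (auto; simpl; lia).
  unfold pd at 3, X. rewrite <- dir_scal by auto. rewrite Rplus_0_l.
  apply (dir_ext (red n)); auto. unfold W.
  intros [| |i j] Hv; simpl in Hv; unfold cT.
  - rewrite dl_diff by discriminate. unfold pd; rewrite !X_const; ring.
  - rewrite dl_diff by discriminate. unfold pd; rewrite !X_const; ring.
  - destruct Hv as [-> Hj]. destruct (Nat.eq_dec j n) as [->|ne].
    + rewrite dl_same, pd_E_next2. ring.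
    + rewrite dl_diff by congruence. rewrite Rmult_0_r.
      destruct (Nat.eq_dec (j + 1) n) as [e|ne'].
      * replace (n + 1)%nat with (j + 2)%nat by lia. rewrite pd_E_top.
        rewrite (pd_out (red 0)); auto; [apply dep_fu|]; simpl; lia.
      * rewrite (pd_out (red (j + 2)) _ (E j)) by (try apply dep_Ej; simpl; lia).
        unfold pd; now rewrite X_const.
Qed.

(** * Order of the flux and lowering the order of the density *)

Lemma flux_order n m F G : jsmooth F -> jsmooth G -> dep (red n) F -> dep (red m) G ->
  D G = (fun p => - T F p) -> dep (red (n + 1)) G.
Proof.
  intros HF HG dF dG EG. induction m as [|m IH].
  - apply dep_red_mono with (2 := dG); lia.
  - destruct (Nat.le_gt_cases (S m) (n + 1)) as [h|h]; [now apply dep_red_mono with (2 := dG)|].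
    apply IH. apply (pd_drop (red (S m)) _ (Vu 0 (S m))); auto using red_S.
    (* Compare u_{m+2}-derivatives: T F has order at most n + 2 < m + 2, so its side is 0. *)
    assert (e := pd_D_S (S m) G HG). rewrite EG in e.
    unfold pd at 1 in e. rewrite X_opp in e by auto using jsmooth_X.
    fold (pd (Vu 0 (S (S m)))) in e.
    rewrite (pd_out (red (n + 2)) _ (T F)), (pd_out (red (S m)) _ G), X_const in e; auto;
      try apply dep_T_red; auto; try (simpl; lia).
    apply functional_extensionality; intros p. apply (f_equal (fun f => f p)) in e. lra.
Qed.

Lemma flux_top n F G : jsmooth F -> jsmooth G -> dep (red n) F -> dep (red (n + 1)) G ->
  D G = (fun p => - T F p) -> P (n + 1) G = fun p => - (A (uu p) * P n F p).
Proof.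
  intros HF HG dF dG EG.
  assert (e := pd_D_S (n + 1) G HG). rewrite EG in e.
  replace (S (n + 1)) with (n + 2)%nat in e by lia.
  unfold pd at 1 in e. rewrite X_opp in e by auto using jsmooth_X.
  fold (pd (Vu 0 (n + 2))) in e. rewrite pd_T_top in e by auto.
  rewrite (pd_out (red (n + 1)) _ G), X_const in e; auto; try (simpl; lia).
  apply functional_extensionality; intros p. apply (f_equal (fun f => f p)) in e. lra.
Qed.

(** Write subscripts for derivatives in u_k. Two u_{n+1}-derivatives of D G = -T F give 2 G_{n,n+1}
    = -2 A_n F_n, where A_n is the u_n-derivative of A(u). The u_n-derivative of the top coefficient
    G_{n+1} = -A F_n gives G_{n,n+1} = -A_n F_n - A F_{nn}. The terms with A_n cancel, leaving A
    F_{nn} = 0. *)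
Lemma density_affine n F G : jsmooth F -> jsmooth G -> dep (red n) F -> dep (red (n + 1)) G ->
  D G = (fun p => - T F p) -> P n (P n F) = fun _ => 0.
Proof.
  intros HF HG dF dG EG.
  assert (e := pd_D_S n G HG). rewrite EG in e. replace (S n) with (n + 1)%nat in e by lia.
  unfold pd at 1 in e. rewrite X_opp in e by auto using jsmooth_X.
  fold (pd (Vu 0 (n + 1))) in e.
  assert (jA := jsmooth_fu A HA). assert (jP := jsmooth_pd (Vu 0 n) F HF).
  assert (jm := jsmooth_mult _ _ jA jP).
  assert (Et := flux_top n F G HF HG dF dG EG).
  apply (f_equal (P (n + 1))) in e. unfold pd at 1 in e.
  rewrite X_opp in e by auto using jsmooth_X, jsmooth_pd, jsmooth_cx.
  fold (pd (Vu 0 (n + 1))) in e. rewrite pd_T_second in e by auto.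
  unfold pd at 3 in e.
  rewrite (X_plus _ (D (P (n + 1) G)) (P n G)) in e by auto using jsmooth_X, jsmooth_pd, jsmooth_cx.
  fold (pd (Vu 0 (n + 1))) in e.
  (* The commutator term is the mixed derivative once more, since G_{n+1} = -A F_n is free of
     u_{n+1}; this produces the factor 2 that matches the other side. *)
  replace (pd (Vu 0 (n + 1)) (D (P (n + 1) G))) with (fun p => P n (P (n + 1) G) p) in e.
  2: { assert (e2 := pd_D_S n (P (n + 1) G) (jsmooth_pd _ _ HG)).
       replace (S n) with (n + 1)%nat in e2 by lia. rewrite e2, Et.
       rewrite (pd_out (red n) (Vu 0 (n + 1)) (fun p => - (A (uu p) * P n F p))).
       - rewrite X_const. apply functional_extensionality; intros; ring.
       - apply (dep_comp1 _ Ropp). apply dep_mult; [apply dep_fu; simpl; lia|now apply dep_pd].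
       - simpl; lia. }
  rewrite (pd_comm (Vu 0 (n + 1)) (Vu 0 n) G) in e by auto.
  rewrite Et in e.
  assert (Eo : P n (fun p => - (A (uu p) * P n F p)) =
    fun p => - (P n (fun q => A (uu q)) p * P n F p + A (uu p) * P n (P n F) p)).
  { unfold pd at 1. rewrite X_opp by auto.
    now rewrite (X_mult _ (fun p => A (uu p)) (P n F)) by auto. }
  rewrite Eo in e.
  apply functional_extensionality; intros p. apply (f_equal (fun f => f p)) in e.
  assert (nz : A (uu p) <> 0) by apply HAB.
  apply Rmult_eq_reg_l with (A (uu p)); auto. lra.
Qed.

(** By affinity the coefficient of the top derivative has order at most m, so its primitive in u_m
    does too, and D of the primitive has the same top coefficient as F. Adding T H to the flux
    preserves the conservation identity because D and T commute. *)
Lemma reduce_order_step m F G : jsmooth F -> jsmooth G -> dep (red (S m)) F ->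
  (exists k, dep (red k) G) -> D G = (fun p => - T F p) ->
  exists H, jsmooth H /\ dep (red m) H /\ dep (red m) (fun p => F p - D H p) /\
    D (fun p => G p + T H p) = fun p => - T (fun q => F q - D H q) p.
Proof.
  intros HF HG dF [k dG] EG.
  assert (dG' := flux_order _ _ _ _ HF HG dF dG EG).
  assert (Haff := density_affine _ _ _ HF HG dF dG' EG).
  set (F1 := P (S m) F). assert (jF1 : jsmooth F1) by now apply jsmooth_pd.
  assert (dF1 : dep (red m) F1).
  { apply (pd_drop (red (S m)) _ (Vu 0 (S m))); auto using red_S. now apply dep_pd. }
  set (H := primitive (Vu 0 m) F1). assert (jH : jsmooth H) by now apply jsmooth_primitive.
  assert (dH : dep (red m) H).
  { apply dep_weak with (2 := dep_primitive _ (Vu 0 m) _ dF1). intros v [h| ->]; auto. simpl; auto. }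
  assert (pH : P m H = F1) by (rewrite <- partial_pd by auto; now apply partial_primitive).
  assert (jDH : jsmooth (D H)) by (apply jsmooth_X; auto using jsmooth_cx).
  assert (jTH : jsmooth (T H)) by (apply jsmooth_X; auto).
  exists H; split; [exact jH|split; [exact dH|split]].
  - apply (pd_drop (red (S m)) _ (Vu 0 (S m))); auto using red_S, jsmooth_minus.
    + apply dep_minus; auto using dep_Dx_red.
    + unfold pd; rewrite X_minus by auto. fold (pd (Vu 0 (S m))).
      rewrite pd_D_S by auto. rewrite pH, (pd_out (red m) _ H), X_const by (auto; simpl; lia).
      apply functional_extensionality; intros p. fold F1. ring.
  - rewrite X_plus, X_minus by auto. rewrite EG, cx_cT_comm by auto.
    apply functional_extensionality; intros p; ring.
Qed.

Lemma reduce_order n : forall F G, jsmooth F -> jsmooth G -> dep (red n) F ->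
  (exists k, dep (red k) G) -> D G = (fun p => - T F p) ->
  exists H, jsmooth H /\ (exists k, dep (red k) H) /\ dep (red 0) (fun p => F p - D H p).
Proof.
  induction n as [|m IH]; intros F G HF HG dF dG EG.
  - exists (fun _ => 0); split; [apply jsmooth_const|]. split; [exists O; apply dep_const|].
    rewrite X_const. intros p q h; now rewrite (dF p q h).
  - destruct (reduce_order_step m F G HF HG dF dG EG) as [H1 [j1 [d1 [dF' EG']]]].
    assert (jD1 : jsmooth (D H1)) by (apply jsmooth_X; auto using jsmooth_cx).
    assert (jT1 : jsmooth (T H1)) by (apply jsmooth_X; auto).
    destruct (IH (fun p => F p - D H1 p) (fun p => G p + T H1 p)) as [H2 [j2 [[k2 d2] dF2]]];
      auto using jsmooth_plus, jsmooth_minus.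
    { destruct dG as [k dG]; exists (k + (m + 2))%nat. apply dep_plus.
      - apply dep_red_mono with (2 := dG); lia.
      - apply dep_red_mono with (2 := dep_T_red A B _ _ d1); lia. }
    exists (fun p => H1 p + H2 p); split; [now apply jsmooth_plus|]. split.
    + exists (m + k2)%nat. apply dep_plus.
      * apply dep_red_mono with (2 := d1); lia.
      * apply dep_red_mono with (2 := d2); lia.
    + rewrite X_plus by auto. intros p q h. generalize (dF2 p q h). lra.
Qed.

Lemma cT_base f p : dep base f -> T f p = pd Vt f p.
Proof.
  intros Hf; apply (dir_ext base); auto.
  intros [| |i j]; simpl; try tauto; unfold dl; destruct jvar_eq_dec; congruence.
Qed.

Lemma cx_base f : dep base f -> D f = pd Vx f.
Proof. intros Hf; apply functional_extensionality; intros p; now apply X_cx_base. Qed.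

(** The flux is never integrated: its u_1-derivative is known from the top coefficient, its
    u_0-derivative follows from the u_1-derivative of D G = -T F, and the u_0-derivative of the same
    identity is then the determining equation, all terms with u_x and u_xx cancelling. *)
Lemma order_zero_equation F G : jsmooth F -> jsmooth G -> dep (red 0) F ->
  (exists k, dep (red k) G) -> D G = (fun p => - T F p) ->
  exists alpha beta, jsmooth alpha /\ jsmooth beta /\ dep base alpha /\ dep base beta /\
    (forall p, F p = alpha p * uu p + beta p) /\
    forall p, partial Vt alpha p + A (uu p) * partial Vx (partial Vx alpha) p
              - B (uu p) * partial Vx alpha p = 0.
Proof.
  intros HF HG dF [k dG] EG.
  assert (dG' := flux_order _ _ _ _ HF HG dF dG EG).
  assert (Haff := density_affine _ _ _ HF HG dF dG' EG).
  assert (Et := flux_top _ _ _ HF HG dF dG' EG).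
  set (alpha := P 0 F). fold alpha in Haff, Et. simpl in Et.
  assert (ja : jsmooth alpha) by now apply jsmooth_pd.
  assert (da : dep base alpha).
  { apply (pd_drop (red 0) _ (Vu 0 0)); auto using red_0. now apply dep_pd. }
  assert (jau : jsmooth (fun p => alpha p * uu p)) by auto using jsmooth_mult, jsmooth_uu.
  exists alpha, (fun p => F p - alpha p * uu p).
  split; [exact ja|split; [auto using jsmooth_minus|split; [exact da|split; [|split]]]].
  - apply (pd_drop (red 0) _ (Vu 0 0)); auto using red_0, jsmooth_minus.
    + intros p q h. rewrite (dF p q h), (base_red 0 _ da p q h).
      unfold uu; now rewrite (h (Vu 0 0)) by (simpl; auto).
    + unfold pd. rewrite X_minus by auto. rewrite (X_mult _ alpha uu) by auto using jsmooth_uu.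
      rewrite X_uu. fold (pd (Vu 0 0)). rewrite Haff. fold alpha.
      apply functional_extensionality; intros p. rewrite dl_same; ring.
  - intros; ring.
  - set (ax := pd Vx alpha). set (axx := pd Vx ax).
    assert (jax : jsmooth ax) by now apply jsmooth_pd.
    assert (dax : dep base ax) by now apply dep_pd.
    assert (jA := jsmooth_fu A HA). assert (jB := jsmooth_fu B HB).
    assert (HA' := smooth1_Derive A HA). assert (jA' := jsmooth_fu _ HA'). assert (jux := jsmooth_ux).
    assert (jA'u := jsmooth_mult _ _ jA' jux).
    assert (jAx := jsmooth_mult _ _ jA jax). assert (jBa := jsmooth_mult _ _ jB ja).
    assert (jA'ua := jsmooth_mult _ _ jA'u ja). assert (jAa := jsmooth_mult _ _ jA ja).
    (* Obtained from G_{u_0} = -(T F)_{u_1} - D(G_{u_1}) with G_{u_1} = -A alpha. *)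
    assert (Gu : P 0 G = fun p => A (uu p) * ax p - B (uu p) * alpha p
                  - Derive A (uu p) * ux p * alpha p).
    { assert (e := pd_D_S 0 G HG). rewrite EG in e. unfold pd at 1 in e.
      rewrite X_opp in e by auto using jsmooth_X. fold (pd (Vu 0 1)) in e.
      rewrite Et in e. rewrite X_opp in e by auto.
      rewrite (X_mult cx (fun p => A (uu p)) alpha), X_fu in e by auto.
      rewrite (cx_base alpha da) in e. fold ax in e.
      apply functional_extensionality; intros p. apply (f_equal (fun f => f p)) in e.
      rewrite pd_T in e by auto.
      rewrite (pd_out (red 0) (Vu 0 1) F), X_const in e by (auto; simpl; lia).
      rewrite (dir_ext (red 0) F p _ (fun v => P 1 (evol A B) p * dl (Vu 0 0) v)) in e; auto.
      2: { intros [| |i j] Hv; simpl in Hv; unfold cT.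
           - rewrite dl_diff by discriminate. unfold pd; rewrite !X_const; ring.
           - rewrite dl_diff by discriminate. unfold pd; rewrite !X_const; ring.
           - destruct Hv as [-> Hj]. replace j with O by lia. rewrite dl_same. unfold Ej; simpl; ring. }
      rewrite dir_scal in e by auto. change (dir F p (dl (Vu 0 0))) with (alpha p) in e.
      rewrite pd_evol_1 in e. unfold cx in e. change (p (Vu 0 1)) with (ux p) in e. lra. }
    intros p.
    (* Now the u_0-derivative, which commutes with D. *)
    assert (e := pd_D_0 G HG). rewrite EG in e. unfold pd at 1 in e.
    rewrite X_opp in e by auto using jsmooth_X. fold (pd (Vu 0 0)) in e. rewrite Gu in e.
    rewrite (X_minus cx (fun p => A (uu p) * ax p - B (uu p) * alpha p)
       (fun p => Derive A (uu p) * ux p * alpha p)) in e by auto using jsmooth_minus.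
    rewrite (X_minus cx (fun p => A (uu p) * ax p) (fun p => B (uu p) * alpha p)) in e by auto.
    rewrite (X_mult cx (fun p => A (uu p)) ax) in e by auto.
    rewrite (X_mult cx (fun p => B (uu p)) alpha) in e by auto.
    rewrite (X_mult cx (fun p => Derive A (uu p) * ux p) alpha) in e by auto.
    rewrite (X_mult cx (fun p => Derive A (uu p)) ux) in e by auto.
    rewrite !X_fu, X_ux, (cx_base alpha da), (cx_base ax dax) in e by auto.
    fold ax in e. fold axx in e.
    apply (f_equal (fun f => f p)) in e.
    rewrite pd_T in e by auto. fold alpha in e. rewrite (cT_base alpha) in e by auto.
    rewrite (dir_ext (red 0) F p _ (fun v => P 0 (evol A B) p * dl (Vu 0 0) v)) in e; auto.
    2: { intros [| |i j] Hv; simpl in Hv; unfold cT.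
         - rewrite dl_diff by discriminate. unfold pd; rewrite !X_const; ring.
         - rewrite dl_diff by discriminate. unfold pd; rewrite !X_const; ring.
         - destruct Hv as [-> Hj]. replace j with O by lia. rewrite dl_same. unfold Ej; simpl; ring. }
    rewrite dir_scal in e by auto. change (dir F p (dl (Vu 0 0))) with (alpha p) in e.
    unfold pd at 2 in e. rewrite X_evol in e.
    rewrite dl_same, !dl_diff in e by discriminate.
    unfold cx in e. change (p (Vu 0 1)) with (ux p) in e.
    rewrite (partial_pd Vx alpha), !partial_pd by auto. fold ax. fold axx. lra.
Qed.
End Reduction.

(** * Conserved vectors and their densities *)

Section Conservation.
Variables A B : R -> R.
Hypothesis HAB : in_class A B.
Notation T := (X (cT A B)).
Notation D := (X cx).
Let cTs := jsmooth_cT A B HAB.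
Let cxs := jsmooth_cx.

(** Evaluation at the points [Kp p] turns an identity on the solution set into one valid at every
    jet point, which may be differentiated freely. *)
Lemma conserved_pullK cv : conserved A B cv ->
  D (pullK A B (snd cv)) = fun p => - T (pullK A B (fst cv)) p.
Proof.
  intros [HF [HG H]]. rewrite <- pullK_Dx, <- pullK_Dt by auto.
  apply functional_extensionality; intros p.
  generalize (H (Kp A B p) (sol_Kp A B HAB p)). rewrite Dx_X, Dt_X by auto.
  unfold pullK. lra.
Qed.

Lemma Dx_primitive f : jsmooth f -> dep base f -> D (primitive Vx f) = f.
Proof.
  intros Hf Hd. rewrite cx_base.
  - rewrite <- partial_pd by now apply jsmooth_primitive. now apply partial_primitive.
  - apply dep_weak with (2 := dep_primitive _ Vx _ Hd). intros v [h| ->]; simpl; auto.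
Qed.

(* The flux of a conserved vector is determined by its density up to a function of t,
   which is absorbed into the potential. *)
Lemma conserved_canonical cv : conserved A B cv ->
  exists alpha, jsmooth alpha /\ dep base alpha /\
    (forall p, partial Vt alpha p + A (uu p) * partial Vx (partial Vx alpha) p
               - B (uu p) * partial Vx alpha p = 0) /\
    forall cv', conserved A B cv' -> (forall p, fst cv' p = alpha p * uu p) ->
      cv_equiv A B cv cv'.
Proof.
  intros Hcv. assert (EG := conserved_pullK cv Hcv).
  destruct Hcv as [HF [HG _]].
  set (F := pullK A B (fst cv)) in *. set (G := pullK A B (snd cv)) in *.
  assert (jF : jsmooth F) by now apply jsmooth_pullK.
  assert (jG : jsmooth G) by now apply jsmooth_pullK.
  destruct (pullK_red_ex A B (fst cv) HF) as [n dF]. fold F in dF.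
  assert (dG := pullK_red_ex A B (snd cv) HG). fold G in dG.
  destruct (reduce_order A B HAB n F G jF jG dF dG EG) as [H1 [j1 [[k1 d1] dF1]]].
  assert (jD1 : jsmooth (D H1)) by now apply jsmooth_X.
  assert (jT1 : jsmooth (T H1)) by now apply jsmooth_X.
  destruct (order_zero_equation A B HAB (fun p => F p - D H1 p) (fun p => G p + T H1 p))
    as [alpha [beta [ja [jb [da [db [Eab Eeq]]]]]]]; auto using jsmooth_plus, jsmooth_minus.
  { destruct dG as [k dG]; exists (k + (k1 + 2))%nat. apply dep_plus.
    - apply dep_red_mono with (2 := dG); lia.
    - apply dep_red_mono with (2 := dep_T_red A B _ _ d1); lia. }
  { rewrite X_plus, X_minus by auto. rewrite EG, cx_cT_comm by auto.
    apply functional_extensionality; intros p; ring. }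
  exists alpha; split; [exact ja|split; [exact da|split; [exact Eeq|]]].
  intros cv' Hcv' E'.
  set (H2 := primitive Vx beta). assert (j2 : jsmooth H2) by now apply jsmooth_primitive.
  assert (d2 : dep base H2).
  { apply dep_weak with (2 := dep_primitive _ Vx _ db). intros v [h| ->]; simpl; auto. }
  set (H := fun p => H1 p + H2 p). assert (jH : jsmooth H) by now apply jsmooth_plus.
  assert (dH : dep (red k1) H) by (apply dep_plus; auto using base_red).
  assert (EF : forall p, F p - D H p = alpha p * uu p).
  { intros p. unfold H. rewrite X_plus by auto. unfold H2. rewrite Dx_primitive by auto.
    generalize (Eab p). lra. }
  assert (EG' := conserved_pullK cv' Hcv').
  destruct Hcv' as [HF' [HG' _]].
  assert (EF' : pullK A B (fst cv') = fun p => alpha p * uu p).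
  { rewrite (functional_extensionality _ _ E'). apply (pullK_red A B 0).
    apply dep_mult; [now apply base_red|]. apply (dep_coord _ (Vu 0 0)); simpl; auto. }
  rewrite EF' in EG'. set (G' := pullK A B (snd cv')) in *.
  assert (jG' : jsmooth G') by now apply jsmooth_pullK.
  assert (jDH : jsmooth (D H)) by now apply jsmooth_X.
  assert (jTH : jsmooth (T H)) by now apply jsmooth_X.
  (* The difference of the fluxes once the densities agree. [D Q = 0] leaves a function of t, whose
     t-primitive corrects the flux without touching the density. *)
  set (Q := fun p => G p + T H p - G' p).
  assert (jQ : jsmooth Q) by exact (jsmooth_minus _ _ (jsmooth_plus _ _ jG jTH) jG').
  assert (DQ : D Q = fun _ => 0).
  { unfold Q. rewrite (X_minus cx (fun p => G p + T H p) G') by auto using jsmooth_plus.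
    rewrite X_plus by auto. rewrite EG, EG', cx_cT_comm by auto.
    rewrite <- (functional_extensionality _ _ EF). rewrite X_minus by auto.
    apply functional_extensionality; intros p; ring. }
  assert (dQ : dep base Q).
  { destruct dG as [k dG]. destruct (pullK_red_ex A B (snd cv') HG') as [k' dG']. fold G' in dG'.
    apply (Dx_order_zero (k + (k1 + 2) + k')); auto.
    - apply dep_minus; [apply dep_plus|].
      + apply dep_red_mono with (2 := dG); lia.
      + apply dep_red_mono with (2 := dep_T_red A B _ _ dH); lia.
      + apply dep_red_mono with (2 := dG'); lia.
    - rewrite DQ; apply dep_const. }
  assert (dQt : dep (fun v => v = Vt) Q).
  { apply (pd_drop base _ Vx); auto.
    - now rewrite <- cx_base.
    - intros [| |i j]; simpl; tauto. }
  set (H3 := primitive Vt Q). assert (j3 : jsmooth H3) by now apply jsmooth_primitive.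
  assert (d3 : dep (fun v => v = Vt) H3).
  { apply dep_weak with (2 := dep_primitive _ Vt _ dQt). tauto. }
  assert (d3' : dep base H3) by (apply dep_weak with (2 := d3); intros v ->; simpl; auto).
  assert (DH3 : D H3 = fun _ => 0).
  { rewrite cx_base by auto. apply (pd_out (fun v => v = Vt)); auto. discriminate. }
  assert (TH3 : T H3 = Q).
  { apply functional_extensionality; intros p. rewrite cT_base by auto.
    rewrite <- partial_pd by auto. unfold H3. now rewrite partial_primitive. }
  assert (jH' : jsmooth (fun p => H3 p - H p)) by now apply jsmooth_minus.
  exists (fun p => H3 p - H p); split; auto. intros p Hp.
  assert (Ep := sol_eq_Kp A B HAB p Hp).
  rewrite Dx_X, Dt_X by auto. split.
  - rewrite X_minus by auto. rewrite DH3, E', <- EF. unfold F, pullK. rewrite <- Ep. ring.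
  (* At a solution [p = Kp p], so D_t of the potential is read off its pullback, where it acts as T;
     the potential has no t-derivatives and is its own pullback. *)
  - assert (Et : X ct (fun p => H3 p - H p) p = Q p - T H p).
    { rewrite Ep at 1. change (pullK A B (X ct (fun p => H3 p - H p)) p = Q p - T H p).
      rewrite pullK_Dt by auto. rewrite (pullK_red A B k1) by (apply dep_minus; auto using base_red).
      rewrite X_minus by auto. now rewrite TH3. }
    rewrite Et. unfold Q, G, G', pullK. rewrite <- Ep. ring.
Qed.

(** If alpha u = -D H', then D H' has order 0, so H' depends on (t, x) only; D H' is then free of u,
    which forces alpha = 0. *)
Lemma trivial_density alpha cv : jsmooth alpha -> dep base alpha ->
  (forall p, fst cv p = alpha p * uu p) -> cv_trivial A B cv -> forall p, alpha p = 0.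
Proof.
  intros ja da Ef [H [jH HH]] p.
  assert (dau : dep (red 0) (fun p => alpha p * uu p)).
  { apply dep_mult; [now apply base_red|]. apply (dep_coord _ (Vu 0 0)); simpl; auto. }
  assert (jau : jsmooth (fun p => alpha p * uu p)) by auto using jsmooth_mult, jsmooth_uu.
  set (H' := pullK A B H). assert (jH' : jsmooth H') by now apply jsmooth_pullK.
  assert (E : D H' = fun p => - (alpha p * uu p)).
  { unfold H'. rewrite <- pullK_Dx by auto. apply functional_extensionality; intros q.
    destruct (HH (Kp A B q) (sol_Kp A B HAB q)) as [e _]. simpl in e.
    rewrite Ef, Dx_X in e by auto.
    change (alpha (Kp A B q) * uu (Kp A B q)) with (pullK A B (fun p => alpha p * uu p) q) in e.
    rewrite (pullK_red A B 0) in e by auto. unfold pullK. lra. }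
  destruct (pullK_red_ex A B H jH) as [n dn]. fold H' in dn.
  assert (dH' : dep base H').
  { apply (Dx_order_zero n); auto. rewrite E. now apply (dep_comp1 _ Ropp). }
  assert (e := pd_D_0 H' jH').
  rewrite (pd_out base (Vu 0 0) H'), X_const in e by auto.
  rewrite E in e. unfold pd in e. rewrite X_opp, (X_mult _ alpha uu), X_uu in e by auto using jsmooth_uu.
  fold (pd (Vu 0 0)) in e. rewrite (pd_out base (Vu 0 0) alpha) in e by auto.
  apply (f_equal (fun f => f p)) in e. rewrite dl_same in e. lra.
Qed.

(** * Conserved vectors built from densities alpha(t, x) u *)

Lemma antideriv_Derive I f : antideriv I f -> Derive I = f.
Proof. intros H; apply functional_extensionality; intros u; apply is_derive_unique, H. Qed.

Lemma antideriv_smooth1 I f : antideriv I f -> smooth1 f -> smooth1 I.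
Proof.
  intros HI Hf n x. destruct n as [|n]; [eexists; apply HI|].
  apply ex_derive_ext with (2 := Hf n x). intros t.
  revert t; induction n; intros t.
  - simpl. symmetry. apply is_derive_unique, HI.
  - simpl. apply Derive_ext, IHn.
Qed.

Lemma ex_antideriv f : smooth1 f -> exists I, antideriv I f /\ I 0 = 0.
Proof.
  intros Hf. exists (fun u => RInt f 0 u); split; [|apply (RInt_point (V := R_CompleteNormedModule))].
  intros u. apply (is_derive_RInt f (fun b => RInt f 0 b) 0).
  - apply filter_forall; intros b. apply (RInt_correct (V := R_CompleteNormedModule)).
    apply (ex_RInt_continuous (V := R_CompleteNormedModule)); intros; now apply smooth1_continuous.
  - now apply smooth1_continuous.
Qed.

Lemma X_ct_base f : dep base f -> X ct f = pd Vt f.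
Proof.
  intros Hf; apply functional_extensionality; intros p. apply (dir_ext base); auto.
  intros [| |i j]; simpl; try tauto; unfold dl; destruct jvar_eq_dec; congruence.
Qed.

(** The flux is designed to cancel all terms with u_x and u_xx on solutions. What is left of the
    divergence is alpha_t u + alpha_xx IA - alpha_x IB, a u-primitive of the determining
    equation. *)
Lemma conserved_of_density alpha IA IB cv : jsmooth alpha -> dep base alpha ->
  antideriv IA A -> antideriv IB B ->
  (forall p, partial Vt alpha p * uu p + partial Vx (partial Vx alpha) p * IA (uu p)
             - partial Vx alpha p * IB (uu p) = 0) ->
  (forall p, fst cv p = alpha p * uu p) ->
  (forall p, snd cv p = - (alpha p * (A (uu p) * ux p)) + partial Vx alpha p * IA (uu p)
                        - alpha p * IB (uu p)) ->
  conserved A B cv.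
Proof.
  intros ja da HIA HIB Heq EF EG.
  assert (HA : smooth1 A) by apply HAB. assert (HB : smooth1 B) by apply HAB.
  destruct cv as [F G]; simpl in EF, EG.
  assert (EF' := functional_extensionality F _ EF). assert (EG' := functional_extensionality G _ EG).
  clear EF EG; rename EF' into EF, EG' into EG.
  assert (Heq' : forall p, pd Vt alpha p * uu p + pd Vx (pd Vx alpha) p * IA (uu p)
             - pd Vx alpha p * IB (uu p) = 0).
  { intros p. rewrite <- (Heq p), !partial_pd by (rewrite ?partial_pd; auto using jsmooth_pd). auto. }
  rewrite (partial_pd Vx alpha ja) in EG.
  set (ax := pd Vx alpha) in *.
  assert (jax : jsmooth ax) by now apply jsmooth_pd.
  assert (dax : dep base ax) by now apply dep_pd.
  assert (jA := jsmooth_fu A HA).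
  assert (sIA := antideriv_smooth1 IA A HIA HA). assert (sIB := antideriv_smooth1 IB B HIB HB).
  assert (jIA := jsmooth_fu IA sIA). assert (jIB := jsmooth_fu IB sIB).
  assert (ju := jsmooth_uu). assert (jux := jsmooth_ux).
  assert (jAu := jsmooth_mult _ _ jA jux). assert (jaAu := jsmooth_mult _ _ ja jAu).
  assert (jxI := jsmooth_mult _ _ jax jIA). assert (jaI := jsmooth_mult _ _ ja jIB).
  assert (jau := jsmooth_mult _ _ ja ju).
  assert (jo := jsmooth_opp _ jaAu). assert (jp := jsmooth_plus _ _ jo jxI).
  assert (jm := jsmooth_minus _ _ jp jaI). cbv beta in *.
  assert (jF : jsmooth F) by now rewrite EF.
  assert (jG : jsmooth G) by now rewrite EG.
  split; [exact jF|split; [exact jG|]]. intros p Hp.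
  simpl. rewrite Dx_X, Dt_X by auto. rewrite EF, EG.
  rewrite (X_mult ct alpha uu), X_uu, X_ct_base by auto.
  rewrite (X_minus cx (fun p => - (alpha p * (A (uu p) * ux p)) + ax p * IA (uu p))
     (fun p => alpha p * IB (uu p))) by auto.
  rewrite (X_plus cx (fun p => - (alpha p * (A (uu p) * ux p))) (fun p => ax p * IA (uu p))) by auto.
  rewrite (X_opp cx (fun p => alpha p * (A (uu p) * ux p))) by auto.
  rewrite (X_mult cx alpha (fun p => A (uu p) * ux p)) by auto.
  rewrite (X_mult cx (fun p => A (uu p)) ux) by auto.
  rewrite (X_mult cx ax (fun p => IA (uu p))) by auto.
  rewrite (X_mult cx alpha (fun p => IB (uu p))) by auto.
  rewrite !X_fu, X_ux, (cx_base alpha da), (cx_base ax dax) by auto. fold ax.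
  rewrite (antideriv_Derive IA A HIA), (antideriv_Derive IB B HIB).
  assert (e := Hp O O). simpl in e. unfold eqn in e.
  generalize (Heq' p). unfold ct, cx. change (p (Vu 0 1)) with (ux p). intros e'.
  assert (e2 : p (Vu 1 0) = A (uu p) * p (Vu 0 2) + Derive A (uu p) * ux p ^ 2 + B (uu p) * ux p) by lra.
  rewrite e2. rewrite <- e'. ring.
Qed.

Lemma conserved_comb2 c1 cv1 c2 cv2 : conserved A B cv1 -> conserved A B cv2 ->
  conserved A B (cv_comb2 c1 cv1 c2 cv2).
Proof.
  intros [jF1 [jG1 H1]] [jF2 [jG2 H2]].
  assert (a1 := jsmooth_mult _ _ (jsmooth_const c1) jF1).
  assert (a2 := jsmooth_mult _ _ (jsmooth_const c2) jF2).
  assert (b1 := jsmooth_mult _ _ (jsmooth_const c1) jG1).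
  assert (b2 := jsmooth_mult _ _ (jsmooth_const c2) jG2).
  assert (a := jsmooth_plus _ _ a1 a2). assert (b := jsmooth_plus _ _ b1 b2).
  split; [exact a|split; [exact b|]]. intros p Hp. unfold cv_comb2; simpl.
  rewrite Dx_X, Dt_X by auto.
  rewrite (X_plus ct (fun p => c1 * fst cv1 p) (fun p => c2 * fst cv2 p)) by auto.
  rewrite (X_plus cx (fun p => c1 * snd cv1 p) (fun p => c2 * snd cv2 p)) by auto.
  rewrite !X_scal by auto.
  generalize (H1 p Hp) (H2 p Hp). rewrite !Dx_X, !Dt_X by auto. intros h1 h2.
  replace 0 with (c1 * (X ct (fst cv1) p + X cx (snd cv1) p) + c2 * (X ct (fst cv2) p + X cx (snd cv2) p))
    by (rewrite h1, h2; ring). ring.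
Qed.

Lemma conserved_main IB : antideriv IB B -> conserved A B (cv_main A IB).
Proof.
  intros HIB. destruct (ex_antideriv A) as [IA [HIA _]]; [apply HAB|].
  apply (conserved_of_density (fun _ => 1) IA IB); auto using jsmooth_const, dep_const;
    intros p; rewrite ?partial_const; simpl; ring.
Qed.

(** A trivial combination has density (c1 + c2 alpha) u, so c1 + c2 alpha vanishes identically; two
    distinct values of alpha give c2 = 0, then c1 = 0. *)
Lemma indep_main IB alpha cv p q : jsmooth alpha -> dep base alpha -> alpha p <> alpha q ->
  (forall p, fst cv p = alpha p * uu p) -> indep2 A B (cv_main A IB) cv.
Proof.
  intros ja da Hpq E c1 c2 H.
  assert (Z : forall r, c1 + c2 * alpha r = 0).
  { apply (trivial_density (fun r => c1 + c2 * alpha r) (cv_comb2 c1 (cv_main A IB) c2 cv)); auto.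
    - apply (jsmooth_plus _ _ (jsmooth_const c1) (jsmooth_mult _ _ (jsmooth_const c2) ja)).
    - apply (dep_plus _ _ _ (dep_const _ c1) (dep_mult _ _ _ (dep_const _ c2) da)).
    - intros r. unfold cv_comb2; simpl. rewrite E; ring. }
  assert (Zp := Z p). assert (Zq := Z q). simpl in Zp, Zq.
  assert (c2 = 0).
  { apply Rmult_eq_reg_r with (alpha p - alpha q); lra. }
  subst; lra.
Qed.

Lemma base_const f p q : jsmooth f -> dep base f -> pd Vt f = (fun _ => 0) ->
  pd Vx f = (fun _ => 0) -> f p = f q.
Proof.
  intros jf df Ht Hx.
  assert (d1 : dep (fun v => v = Vt) f).
  { apply (pd_drop base _ Vx); auto. intros [| |i j]; simpl; tauto. }
  assert (d2 : dep (fun _ => False) f) by (apply (pd_drop (fun v => v = Vt) _ Vt); auto).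
  apply d2; tauto.
Qed.
End Conservation.

(** * Classification *)

Lemma smooth1_const c : smooth1 (fun _ => c).
Proof.
  intros n x. apply ex_derive_ext with (fun _ => match n with O => c | _ => 0 end);
    [|apply ex_derive_const].
  intros t; revert t; induction n; intros t; auto. simpl.
  rewrite <- (Derive_ext _ _ t IHn). symmetry; apply Derive_const.
Qed.

Lemma smooth1_exp : smooth1 exp.
Proof.
  assert (H : forall n t, exp t = Derive_n exp n t).
  { induction n; intros t; auto. simpl. rewrite <- (Derive_ext _ _ t IHn).
    symmetry; apply is_derive_unique, is_derive_exp. }
  intros n x. apply ex_derive_ext with (1 := H n). eexists; apply is_derive_exp.
Qed.

Lemma smooth1_scal c A : smooth1 A -> smooth1 (fun u => c * A u).
Proof.
  intros HA n x. apply ex_derive_ext with (fun t => c * Derive_n A n t).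
  - intros t; symmetry; apply Derive_n_scal_l.
  - apply (ex_derive_mult (fun _ => c) (Derive_n A n)); [apply ex_derive_const|apply HA].
Qed.

Lemma in_class_const a b : a <> 0 -> in_class (fun _ => a) (fun _ => b).
Proof. intros Ha; split; [apply smooth1_const|split; [apply smooth1_const|auto]]. Qed.

(** Group transformations preserve affine dependence of B on A, and each normal form has it.
    Conversely the coefficients c1, c2 prescribe the transformation to the normal form. *)
Lemma exceptional_iff_affine A B : in_class A B ->
  exceptional A B <-> exists c1 c2, forall u, B u = c1 + c2 * A u.
Proof.
  intros [HA [HB nz]]. split.
  - assert (aux : forall e3 e4 e5 e6 e7 : R, e4 * e5 * e6 <> 0 -> forall u b, b = e5 / e4 * B u - e7 ->
      B u = e7 * e4 / e5 + e4 / e5 * b).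
    { intros e3 e4 e5 e6 e7 ne u b ->. field.
      split; intros e; apply ne; rewrite e; ring. }
    intros [[A0 [_ [_ H]]]|[[A0 [_ [_ H]]]|H]]; destruct H as [e3 [e4 [e5 [e6 [e7 [ne H]]]]]].
    + exists (e7 * e4 / e5), 0. intros u. destruct (H u) as [_ H2].
      rewrite (aux e3 e4 e5 e6 e7 ne u _ H2). unfold zeroF. ring.
    + exists (e7 * e4 / e5), e5. intros u. destruct (H u) as [H1 H2].
      rewrite (aux e3 e4 e5 e6 e7 ne u _ H2), H1. field.
      split; intros e; apply ne; rewrite e; ring.
    + exists (e7 * e4 / e5), 0. intros u. destruct (H u) as [_ H2].
      rewrite (aux e3 e4 e5 e6 e7 ne u _ H2). unfold zeroF. ring.
  - intros [c1 [c2 H]]. destruct (classic (nonconst A)) as [[a [b Hab]]|Hc].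
    + destruct (Req_dec c2 0) as [->|n2].
      * left. exists A; split; [|split; [now exists a, b|]].
        { split; [exact HA|split; [exact (smooth1_const 0)|exact nz]]. }
        (* B is the constant c1, removed by the Galilean shift. *)
        exists 0, 1, 1, 1, c1. split; [lra|]. intros u.
        replace (1 * u + 0) with u by ring. rewrite H. unfold zeroF. split; field.
      * right; left. exists (fun u => c2 ^ 2 * A u).
        split; [|split].
        -- split; [now apply smooth1_scal|split; [now apply smooth1_scal|]].
           intros u; apply Rmult_integral_contrapositive; split; auto. now apply pow_nonzero.
        -- exists a, b. intros e. apply Hab, Rmult_eq_reg_l with (c2 ^ 2); auto. now apply pow_nonzero.
        (* Scaling x by c2 turns A into c2^2 A and B into c2 c1 + c2^2 A; the shift by c2 c1 makes
           them equal. *)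
        -- exists 0, 1, c2, 1, (c2 * c1). split; [lra|]. intros u.
           replace (1 * u + 0) with u by ring. rewrite H. split; field.
    + right; right.
      assert (EA : forall u, A u = A 0).
      { intros u; apply NNPP; intros n; apply Hc; now exists u, 0. }
      (* Both coefficients are constant: scaling t by A(0), of either sign, normalizes A to 1, and
         the shift removes the rescaled B. *)
      exists 0, (A 0), 1, 1, (B 0 / A 0). split; [rewrite 2!Rmult_1_r; auto|].
      intros u. rewrite (H u), (H 0), (EA u). unfold oneF, zeroF. split; field; auto.
Qed.

(** * Solutions of the determining equation *)

Lemma jsmooth_exp_linear s r : jsmooth (fun p => exp (s * p Vx + r * p Vt)).
Proof.
  apply jsmooth_comp1; [apply smooth1_exp|].
  repeat (apply jsmooth_plus || apply jsmooth_mult); auto using jsmooth_const, jsmooth_coord.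
Qed.

Lemma dep_base_linear s r : dep base (fun p => s * p Vx + r * p Vt).
Proof. intros p q h. rewrite (h Vx), (h Vt); simpl; auto. Qed.

Lemma partial_linear v s r : partial v (fun p => s * p Vx + r * p Vt) =
  fun _ => s * dl v Vx + r * dl v Vt.
Proof.
  assert (j1 := jsmooth_coord Vx). assert (j2 := jsmooth_coord Vt).
  assert (k1 := jsmooth_mult _ _ (jsmooth_const s) j1).
  assert (k2 := jsmooth_mult _ _ (jsmooth_const r) j2).
  rewrite partial_pd by (now apply jsmooth_plus). unfold pd.
  rewrite (X_plus _ (fun p => s * p Vx) (fun p => r * p Vt)), !X_scal, !X_coord by auto. reflexivity.
Qed.

Lemma partial_exp_linear v c s r : partial v (fun p => c * exp (s * p Vx + r * p Vt)) =
  fun p => c * (s * dl v Vx + r * dl v Vt) * exp (s * p Vx + r * p Vt).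
Proof.
  assert (jl := jsmooth_plus _ _ (jsmooth_mult _ _ (jsmooth_const s) (jsmooth_coord Vx))
     (jsmooth_mult _ _ (jsmooth_const r) (jsmooth_coord Vt))).
  assert (je := jsmooth_exp_linear s r).
  rewrite partial_pd by (apply jsmooth_mult; auto using jsmooth_const). unfold pd.
  rewrite X_scal, (X_comp1 _ exp (fun p => s * p Vx + r * p Vt)) by auto using smooth1_exp.
  fold (pd v). rewrite <- partial_pd, partial_linear by auto.
  apply functional_extensionality; intros p.
  rewrite (is_derive_unique exp _ _ (is_derive_exp _)). ring.
Qed.

(* The witnesses are x + c1 t and exp (c2 x + c1 c2 t). *)
Lemma affine_second_density (A B : R -> R) c1 c2 : (forall u, B u = c1 + c2 * A u) ->
  exists alpha, jsmooth alpha /\ dep base alpha /\ (exists p q, alpha p <> alpha q) /\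
    forall p u, partial Vt alpha p + A u * partial Vx (partial Vx alpha) p
              - B u * partial Vx alpha p = 0.
Proof.
  intros H. set (p1 := fun v : jvar => match v with Vx => 1 | _ => 0 end).
  destruct (Req_dec c2 0) as [->|n2].
  - exists (fun p => 1 * p Vx + c1 * p Vt). split; [|split; [|split]].
    + repeat (apply jsmooth_plus || apply jsmooth_mult); auto using jsmooth_const, jsmooth_coord.
    + apply dep_base_linear.
    + exists p1, (fun _ => 0). unfold p1; lra.
    + intros p u. rewrite !partial_linear, partial_const, H.
      rewrite !dl_same, !dl_diff by discriminate. ring.
  - exists (fun p => 1 * exp (c2 * p Vx + (c1 * c2) * p Vt)). split; [|split; [|split]].
    + apply jsmooth_mult; auto using jsmooth_const, jsmooth_exp_linear.
    + apply (dep_comp1 base (fun y => 1 * exp y)), dep_base_linear.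
    + exists p1, (fun _ => 0). unfold p1. intros e. apply n2.
      assert (exp (c2 * 1 + c1 * c2 * 0) = exp (c2 * 0 + c1 * c2 * 0)) as e' by lra.
      apply exp_inv in e'. lra.
    + intros p u. rewrite !partial_exp_linear, H.
      rewrite !dl_same, !dl_diff by discriminate. ring.
Qed.

(** As alpha does not involve u, the coordinate u can be varied with (t, x) fixed. *)
Lemma density_eq_at (A B : R -> R) alpha : dep base alpha ->
  (forall p, partial Vt alpha p + A (uu p) * partial Vx (partial Vx alpha) p
             - B (uu p) * partial Vx alpha p = 0) ->
  forall p u, partial Vt alpha p + A u * partial Vx (partial Vx alpha) p
             - B u * partial Vx alpha p = 0.
Proof.
  intros da H p u. generalize (H (upd p (Vu 0 0) u)). unfold uu. rewrite upd_same.
  assert (E : forall f, dep base f -> f (upd p (Vu 0 0) u) = f p).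
  { intros f df; apply df. intros v Hv; apply upd_other. intros ->; exact Hv. }
  rewrite !E; auto using dep_partial.
Qed.

Lemma ex_second_law A B IB : in_class A B -> (exists c1 c2, forall u, B u = c1 + c2 * A u) ->
  exists cv, conserved A B cv /\ indep2 A B (cv_main A IB) cv.
Proof.
  intros HAB [c1 [c2 H]].
  destruct (affine_second_density A B c1 c2 H) as [al [ja [da [[p [q n]] Heq]]]].
  destruct (ex_antideriv A) as [IA [HIA IA0]]; [apply HAB|].
  destruct (ex_antideriv B) as [IB' [HIB IB0]]; [apply HAB|].
  exists (fun p => al p * uu p, fun p => - (al p * (A (uu p) * ux p)) + partial Vx al p * IA (uu p)
                        - al p * IB' (uu p)). split.
  - apply (conserved_of_density A B HAB al IA IB'); auto. intros r.
    (* At fixed (t, x) the remaining divergence is a function of u with derivative 0 by the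
       determining equation; the antiderivatives normalized at 0 make it vanish at u = 0, hence
       everywhere. *)
    set (g := fun u => partial Vt al r * u + partial Vx (partial Vx al) r * IA u - partial Vx al r * IB' u).
    assert (Dg : forall u, is_derive g u zero).
    { intros u. change (is_derive g u 0); rewrite <- (Heq r u).
      unfold g. auto_derive.
      - repeat split; eexists; [apply HIA|apply HIB].
      - replace (Derive (fun x : R => IA x) u) with (A u) by (symmetry; apply is_derive_unique, HIA).
        replace (Derive (fun x : R => IB' x) u) with (B u) by (symmetry; apply is_derive_unique, HIB).
        ring. }
    assert (G0 : g 0 = 0) by (unfold g; rewrite IA0, IB0; ring).
    change (g (uu r) = 0). rewrite <- G0.
    destruct (Rtotal_order (uu r) 0) as [h|[->|h]]; auto.
    + apply (eq_is_derive g); auto.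
    + symmetry; apply (eq_is_derive g); auto.
  - apply (indep_main A B HAB IB al _ p q); auto.
Qed.

(** If alpha_x were nonzero at a single point, dividing the equation by it there would exhibit B as
    affine in A. So alpha_x = 0, and the equation then gives alpha_t = 0. *)
Lemma non_affine_density (A B : R -> R) alpha : jsmooth alpha -> dep base alpha ->
  (forall p, partial Vt alpha p + A (uu p) * partial Vx (partial Vx alpha) p
             - B (uu p) * partial Vx alpha p = 0) ->
  ~ (exists c1 c2, forall u, B u = c1 + c2 * A u) -> exists c, forall p, alpha p = c.
Proof.
  intros ja da H nA. assert (H' := density_eq_at A B alpha da H).
  assert (Hx : pd Vx alpha = fun _ => 0).
  { rewrite <- partial_pd by auto. apply functional_extensionality; intros p.
    apply NNPP; intros n. apply nA.
    exists (partial Vt alpha p / partial Vx alpha p),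
      (partial Vx (partial Vx alpha) p / partial Vx alpha p).
    intros u. apply Rmult_eq_reg_r with (partial Vx alpha p); auto.
    transitivity (partial Vt alpha p + A u * partial Vx (partial Vx alpha) p).
    - generalize (H' p u); lra.
    - field; auto. }
  exists (alpha (fun _ => 0)). intros p. apply base_const; auto.
  apply functional_extensionality; intros q. generalize (H' q 0).
  rewrite !partial_pd by (rewrite ?partial_pd; auto using jsmooth_pd).
  rewrite Hx. unfold pd at 2. rewrite X_const. lra.
Qed.

(** Two values of u with different A separate the terms with and without A. The parameter [k] covers
    B = 0 and B = A together. *)
Lemma density_eq_split A k alpha : nonconst A -> jsmooth alpha -> dep base alpha ->
  (forall p, partial Vt alpha p + A (uu p) * partial Vx (partial Vx alpha) p
             - k * A (uu p) * partial Vx alpha p = 0) ->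
  pd Vt alpha = (fun _ => 0) /\ pd Vx (pd Vx alpha) = fun p => k * pd Vx alpha p.
Proof.
  intros [a [b Hab]] ja da H.
  assert (H' := density_eq_at A (fun u => k * A u) alpha da H). cbv beta in H'.
  rewrite !(partial_pd Vx) in H' by (rewrite ?partial_pd; auto using jsmooth_pd).
  rewrite (partial_pd Vt) in H' by auto.
  assert (E : forall p, pd Vx (pd Vx alpha) p - k * pd Vx alpha p = 0).
  { intros p. apply Rmult_eq_reg_l with (A a - A b); [|lra].
    generalize (H' p a) (H' p b). lra. }
  split; apply functional_extensionality; intros p.
  - generalize (H' p a) (E p). intros h1 h2.
    replace (pd Vx (pd Vx alpha) p) with (k * pd Vx alpha p) in h1 by lra. lra.
  - generalize (E p). lra.
Qed.

Lemma density_case_a A alpha : nonconst A -> jsmooth alpha -> dep base alpha ->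
  (forall p, partial Vt alpha p + A (uu p) * partial Vx (partial Vx alpha) p
             - zeroF (uu p) * partial Vx alpha p = 0) ->
  exists c1 c2, forall p, alpha p = c1 + c2 * p Vx.
Proof.
  intros nA ja da H.
  destruct (density_eq_split A 0 alpha nA ja da) as [Ht Hx].
  { intros p. generalize (H p). unfold zeroF; lra. }
  set (p0 := fun _ : jvar => 0). set (c2 := pd Vx alpha p0).
  assert (jx := jsmooth_pd Vx alpha ja).
  assert (Ec : pd Vx alpha = fun _ => c2).
  { apply functional_extensionality; intros p. apply base_const; auto using dep_pd.
    - now rewrite pd_comm, Ht by auto; unfold pd; rewrite X_const.
    - rewrite Hx. apply functional_extensionality; intros; ring. }
  assert (jl := jsmooth_mult _ _ (jsmooth_const c2) (jsmooth_coord Vx)).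
  exists (alpha p0), c2. intros p.
  assert (E : alpha p - c2 * p Vx = alpha p0 - c2 * p0 Vx).
  { apply (base_const (fun p => alpha p - c2 * p Vx)).
    - now apply jsmooth_minus.
    - apply dep_minus; auto. apply dep_mult; [apply dep_const|apply dep_coord; simpl; auto].
    - unfold pd. rewrite (X_minus _ alpha (fun p => c2 * p Vx)), X_scal, X_coord by auto using jsmooth_coord.
      fold (pd Vt). rewrite Ht, dl_diff by discriminate.
      apply functional_extensionality; intros; ring.
    - unfold pd. rewrite (X_minus _ alpha (fun p => c2 * p Vx)), X_scal, X_coord by auto using jsmooth_coord.
      fold (pd Vx). rewrite Ec, dl_same. apply functional_extensionality; intros; ring. }
  unfold p0 at 2 in E. lra.
Qed.

Lemma jsmooth_exp s : jsmooth (fun p => exp (s * p Vx)).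
Proof.
  apply jsmooth_comp1; [apply smooth1_exp|].
  apply jsmooth_mult; auto using jsmooth_const, jsmooth_coord.
Qed.

Lemma pd_exp v s : pd v (fun p => exp (s * p Vx)) = fun p => s * dl v Vx * exp (s * p Vx).
Proof.
  assert (jl := jsmooth_mult _ _ (jsmooth_const s) (jsmooth_coord Vx)).
  unfold pd. rewrite (X_comp1 _ exp (fun p => s * p Vx)), X_scal, X_coord
    by auto using smooth1_exp, jsmooth_coord.
  apply functional_extensionality; intros p.
  rewrite (is_derive_unique exp _ _ (is_derive_exp _)). ring.
Qed.

Lemma dep_base_exp s : dep base (fun p => exp (s * p Vx)).
Proof. apply (dep_comp1 base (fun y => exp (s * y))), dep_coord; simpl; auto. Qed.

(** The split equation alpha_xx = alpha_x is solved with the integrating factor exp(-x): alpha_x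
    exp(-x) is a constant c2, and then alpha - c2 exp(x) is constant as well. *)
Lemma density_case_b A alpha : nonconst A -> jsmooth alpha -> dep base alpha ->
  (forall p, partial Vt alpha p + A (uu p) * partial Vx (partial Vx alpha) p
             - A (uu p) * partial Vx alpha p = 0) ->
  exists c1 c2, forall p, alpha p = c1 + c2 * exp (p Vx).
Proof.
  intros nA ja da H.
  destruct (density_eq_split A 1 alpha nA ja da) as [Ht Hx].
  { intros p. generalize (H p). lra. }
  set (p0 := fun _ : jvar => 0).
  assert (jx := jsmooth_pd Vx alpha ja).
  assert (jm := jsmooth_exp (-1)). assert (jp := jsmooth_exp 1).
  set (c2 := pd Vx alpha p0 * exp (-1 * p0 Vx)).
  assert (Ec : pd Vx alpha = fun p => c2 * exp (1 * p Vx)).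
  { apply functional_extensionality; intros p.
    assert (E : pd Vx alpha p * exp (-1 * p Vx) = c2).
    { apply (base_const (fun p => pd Vx alpha p * exp (-1 * p Vx))).
      - now apply jsmooth_mult.
      - apply dep_mult; auto using dep_pd, dep_base_exp.
      - unfold pd at 1. rewrite (X_mult _ (pd Vx alpha) (fun p => exp (-1 * p Vx))) by auto.
        fold (pd Vt). rewrite pd_comm, Ht, pd_exp, dl_diff by (auto; discriminate).
        unfold pd; rewrite X_const. apply functional_extensionality; intros; ring.
      - unfold pd at 1. rewrite (X_mult _ (pd Vx alpha) (fun p => exp (-1 * p Vx))) by auto.
        fold (pd Vx). rewrite Hx, pd_exp, dl_same.
        apply functional_extensionality; intros; ring. }
    rewrite <- E, Rmult_assoc, <- exp_plus.
    replace (-1 * p Vx + 1 * p Vx) with 0 by ring. rewrite exp_0; ring. }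
  assert (jl := jsmooth_mult _ _ (jsmooth_const c2) jp).
  exists (alpha p0 - c2 * exp (1 * p0 Vx)), c2. intros p.
  assert (E : alpha p - c2 * exp (1 * p Vx) = alpha p0 - c2 * exp (1 * p0 Vx)).
  { apply (base_const (fun p => alpha p - c2 * exp (1 * p Vx))).
    - now apply jsmooth_minus.
    - apply dep_minus; auto. apply dep_mult; [apply dep_const|apply dep_base_exp].
    - unfold pd. rewrite (X_minus _ alpha (fun p => c2 * exp (1 * p Vx))), X_scal by auto.
      fold (pd Vt). rewrite Ht, pd_exp, dl_diff by discriminate.
      apply functional_extensionality; intros; ring.
    - unfold pd. rewrite (X_minus _ alpha (fun p => c2 * exp (1 * p Vx))), X_scal by auto.
      fold (pd Vx). rewrite Ec, pd_exp, dl_same. apply functional_extensionality; intros; ring. }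
  replace (p Vx) with (1 * p Vx) by ring. lra.
Qed.

(** Since a conserved vector is determined by its canonical density up to equivalence, spanning
    reduces to solving the determining equation by combinations of 1 and [f]. *)
Lemma spanned2_of_density A B IB f cv : in_class A B -> antideriv IB B ->
  jsmooth f -> dep base f -> (exists p q, f p <> f q) ->
  (forall p, fst cv p = f p * uu p) -> conserved A B cv ->
  (forall alpha, jsmooth alpha -> dep base alpha ->
    (forall p, partial Vt alpha p + A (uu p) * partial Vx (partial Vx alpha) p
             - B (uu p) * partial Vx alpha p = 0) ->
    exists c1 c2, forall p, alpha p = c1 + c2 * f p) ->
  spanned2 A B (cv_main A IB) cv.
Proof.
  intros HAB HIB jf df [p [q n]] Ef Hcv Hsol.
  assert (Hm := conserved_main A B HAB IB HIB).
  split; [exact Hm|split; [exact Hcv|split]].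
  - now apply (indep_main A B HAB IB f cv p q).
  - intros cv' H'. destruct (conserved_canonical A B HAB cv' H') as [al [ja [da [Heq Huniv]]]].
    destruct (Hsol al ja da Heq) as [c1 [c2 Hal]].
    exists c1, c2. apply Huniv; [now apply conserved_comb2|].
    intros r. unfold cv_comb2; simpl. rewrite Ef, Hal. ring.
Qed.

Lemma conserved_scale A B c cv : conserved A B cv -> conserved A B (cv_scale c cv).
Proof.
  intros [jF [jG H]].
  assert (a := jsmooth_mult _ _ (jsmooth_const c) jF). assert (b := jsmooth_mult _ _ (jsmooth_const c) jG).
  split; [exact a|split; [exact b|]]. intros p Hp. unfold cv_scale; simpl.
  rewrite Dx_X, Dt_X, !X_scal by auto.
  generalize (H p Hp). rewrite Dx_X, Dt_X by auto. intros h.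
  rewrite <- Rmult_plus_distr_l, h. ring.
Qed.

Lemma only_main_law A B IB cv : in_class A B -> antideriv IB B -> ~ exceptional A B ->
  conserved A B cv -> exists c, cv_equiv A B cv (cv_scale c (cv_main A IB)).
Proof.
  intros HAB HIB He Hcv.
  destruct (conserved_canonical A B HAB cv Hcv) as [al [ja [da [Heq Huniv]]]].
  destruct (non_affine_density A B al ja da Heq) as [c Hc].
  { now rewrite <- (exceptional_iff_affine A B HAB). }
  exists c. apply Huniv.
  - apply conserved_scale. now apply conserved_main.
  - intros p; rewrite Hc; reflexivity.
Qed.

(** The combination with coefficients c and -1 is trivial, with the opposite potential. *)
Lemma scale_equiv_dependent A B cv cv' c : cv_equiv A B cv (cv_scale c cv') -> ~ indep2 A B cv' cv.
Proof.
  intros [H [jH E]] Hi. destruct (Hi c (-1)) as [_ h]; [|lra].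
  exists (fun p => - H p); split; [now apply jsmooth_opp|].
  intros p Hp. destruct (E p Hp) as [E1 E2]. simpl in *.
  assert (jo := jsmooth_opp _ jH). rewrite Dx_X, Dt_X in * by auto.
  rewrite !X_opp by auto. lra.
Qed.

Theorem theorem4 :
  (* (i) *)
  (forall A B IB : R -> R, in_class A B -> antideriv IB B ->
     conserved A B (cv_main A IB)) /\
  (* (ii) classification *)
  (forall A B IB : R -> R, in_class A B -> antideriv IB B ->
     ((exists cv, conserved A B cv /\ indep2 A B (cv_main A IB) cv)
      <-> exceptional A B)) /\
  (* (ii)(a) *)
  (forall A IA : R -> R, in_class A zeroF -> nonconst A -> antideriv IA A ->
     spanned2 A zeroF (cv_main A zeroF) (cv_a A IA)) /\
  (* (ii)(b) *)
  (forall A IA : R -> R, in_class A A -> nonconst A -> antideriv IA A ->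
     spanned2 A A (cv_main A IA) (cv_b A)) /\
  (* (ii)(c) *)
  ((forall alpha : R -> R -> R, jsmooth (alj alpha) -> backward_heat alpha ->
      conserved oneF zeroF (cv_c alpha)) /\
   (forall cv, conserved oneF zeroF cv ->
      exists alpha : R -> R -> R, jsmooth (alj alpha) /\ backward_heat alpha /\
        cv_equiv oneF zeroF cv (cv_c alpha))) /\
  (* all other equations *)
  (forall A B IB : R -> R, in_class A B -> antideriv IB B -> ~ exceptional A B ->
     forall cv, conserved A B cv ->
       exists c : R, cv_equiv A B cv (cv_scale c (cv_main A IB))).
Proof.
  assert (zero_antideriv : antideriv zeroF zeroF) by (intros u; apply @is_derive_const).
  assert (id_antideriv : antideriv (fun u => u) oneF) by (intros u; apply @is_derive_id).
  set (p1 := fun v : jvar => match v with Vx => 1 | _ => 0 end).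
  assert (Hheat : in_class oneF zeroF) by (apply (in_class_const 1 0); lra).
  assert (Hc : forall alpha : R -> R -> R, jsmooth (alj alpha) -> backward_heat alpha ->
      conserved oneF zeroF (cv_c alpha)).
  { intros alpha ja Hb.
    (* With u as antiderivative of 1, the remaining divergence is the backward heat equation times
       u. *)
    apply (conserved_of_density _ _ Hheat (alj alpha) (fun u => u) zeroF); auto.
    - intros p q h; unfold alj; now rewrite (h Vt), (h Vx) by (simpl; auto).
    - intros p. transitivity ((partial Vt (alj alpha) p + partial Vx (partial Vx (alj alpha)) p) * uu p);
        [unfold zeroF; ring|rewrite (Hb p); ring].
    - intros p. unfold oneF, zeroF; simpl. ring. }
  split; [|split; [|split; [|split; [|split; [split; [exact Hc|]|]]]]].
  - intros A B IB HAB HIB. now apply conserved_main.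
  - intros A B IB HAB HIB. split.
    + intros [cv [Hcv Hi]]. apply NNPP; intros He.
      destruct (only_main_law A B IB cv HAB HIB He Hcv) as [c H].
      now apply (scale_equiv_dependent A B cv (cv_main A IB) c).
    + intros He. apply ex_second_law; auto. now apply exceptional_iff_affine.
  - intros A IA HAB nA HIA.
    apply (spanned2_of_density A zeroF zeroF (fun p => p Vx)); auto.
    + apply jsmooth_coord.
    + apply dep_coord; simpl; auto.
    + exists p1, (fun _ => 0). unfold p1; lra.
    + apply (conserved_of_density _ _ HAB (fun p => p Vx) IA zeroF); auto.
      * apply jsmooth_coord.
      * apply dep_coord; simpl; auto.
      * intros p. rewrite !partial_coord. simpl. rewrite partial_const. unfold zeroF. ring.
      * intros p. rewrite partial_coord. unfold zeroF. simpl. ring.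
    + intros al ja da. now apply density_case_a.
  - intros A IA HAB nA HIA.
    assert (E1 : (fun p : jpt => exp (p Vx)) = fun p => exp (1 * p Vx)).
    { apply functional_extensionality; intros p; now rewrite Rmult_1_l. }
    assert (je : jsmooth (fun p => exp (p Vx))) by (rewrite E1; apply jsmooth_exp).
    assert (de : dep base (fun p => exp (p Vx))) by (rewrite E1; apply dep_base_exp).
    assert (Dt1 : partial Vt (fun p => exp (p Vx)) = fun _ => 0).
    { rewrite partial_pd, E1, pd_exp, dl_diff by (auto; discriminate).
      apply functional_extensionality; intros; ring. }
    assert (Dx1 : partial Vx (fun p => exp (p Vx)) = fun p => exp (p Vx)).
    { rewrite partial_pd, E1, pd_exp, dl_same by auto.
      apply functional_extensionality; intros; ring. }
    apply (spanned2_of_density A A IA (fun p => exp (p Vx))); auto.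
    + exists p1, (fun _ => 0). unfold p1. intros e; apply exp_inv in e; lra.
    (* With alpha = alpha_x and one antiderivative for A = B, the terms alpha_x IA and alpha IB of
       the general flux cancel. *)
    + apply (conserved_of_density _ _ HAB (fun p => exp (p Vx)) IA IA); auto.
      * intros p. rewrite Dt1, !Dx1. ring.
      * intros p. rewrite Dx1. simpl. ring.
    + intros al ja da. now apply density_case_b.
  - intros cv Hcv.
    destruct (conserved_canonical _ _ Hheat cv Hcv) as [al [ja [da [Heq Huniv]]]].
    (* The density coefficient depends on t and x only, so filling the other jet coordinates with 0
       recovers it as a function of two reals. *)
    set (pt := fun t x v => match v with Vt => t | Vx => x | _ => 0 end).
    assert (E : alj (fun t x => al (pt t x)) = al).
    { apply functional_extensionality; intros p. apply da. intros [| |i j]; simpl; tauto. }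
    assert (jb : jsmooth (alj (fun t x => al (pt t x)))) by now rewrite E.
    assert (Hb : backward_heat (fun t x => al (pt t x))).
    { intros p. rewrite E. generalize (Heq p). unfold oneF, zeroF; lra. }
    exists (fun t x => al (pt t x)); split; [exact jb|split; [exact Hb|]].
    apply Huniv; [now apply Hc|]. intros p. simpl. now rewrite E.
  - intros A B IB HAB HIB He cv Hcv. now apply only_main_law.
Qed.
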